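(* Let $(\xi_i)_{i\ge 1}$ be i.i.d. copies of a strictly positive random variable $\xi$ with distribution function $G(x)=\mathrm{P}(\xi\le x)$, and assume that $G$ has a bounded continuous density $g$ on $(0,\infty)$ with $g(\tfrac12)>0$. For $n\ge 1$ let $$M_n=\max_{A\subseteq\{1,\dots,n\}}\Big(|A|-\sum_{i=1}^{n-1}\xi_i\,\mathbf 1(i\in A,\ i+1\in A)\Big).$$ Then there exists a constant $c$ with $\tfrac12\le c\le 1$ such that $$\lim_{n\to\infty} n^{-1}M_n=c\quad\text{almost surely and in }L^1 .$$ The constant is $$c=\tfrac12+\tfrac12\,\mathrm{P}\big(\xi<\min(X^L,X^R)\big)-\mathrm{E}\big[\xi\,\mathbf 1(\xi<\min(X^L,X^R))\big],$$ where $X^L,\xi,X^R$ are independent, $\xi$ has distribution function $G$, and $X^L,X^R$ are $[0,1]$-valued with common distribution function $$F(x)=\frac{\overline G(1-x)\,G(x)}{1-\overline G(x)\,\overline G(1-x)},\qquad 0\le x\le 1,$$ with $\overline G=1-G$. If $\xi$ is exponential with parameter $\lambda>0$ then $c=(1-e^{-\lambda})^{-1}-\lambda^{-1}$.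
   Context: $|A|$ denotes cardinality and $\mathbf 1(\cdot)$ the indicator function. *)

(* Defs.v *)
(* Random variables are indexed from 0, so that [xi i] is
   the variable usually written xi_(i+1), and {1, ..., n} becomes 'I_n. *)
From HB Require Import structures.
From mathcomp Require Import all_boot all_order all_algebra.
From mathcomp Require Import all_classical all_reals all_analysis.
Import Order.TTheory GRing.Theory Num.Theory.
Import numFieldNormedType.Exports.

Set Implicit Arguments.
Unset Strict Implicit.
Unset Printing Implicit Defensive.

Local Open Scope classical_set_scope.
Local Open Scope ring_scope.

(* Product rule over every finite subfamily, a subfamily being listed by a
   duplicate-free sequence of indices. *)
Definition mutually_independent (I : eqType) d (T : measurableType d)
    (R : realType) (P : probability T R) (X : I -> {RV P >-> R}) : Prop :=
  forall (s : seq I) (B : I -> set R),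
    uniq s -> (forall i, measurable (B i)) ->
    P (\bigcap_(i in [set` s]) X i @^-1` B i)
      = (\prod_(i <- s) P (X i @^-1` B i))%E.

(* Laws are compared on measurable sets only: [distribution P X] is also
   defined, but meaningless, on the other sets. *)
Definition same_law (R : realType) d (T : measurableType d)
    (P : probability T R) (X : {RV P >-> R}) d' (T' : measurableType d')
    (P' : probability T' R) (X' : {RV P' >-> R}) : Prop :=
  forall B : set R, measurable B -> distribution P X B = distribution P' X' B.

Definition iid_copies (R : realType) d0 (T0 : measurableType d0)
    (P0 : probability T0 R) (X : {RV P0 >-> R}) d (T : measurableType d)
    (P : probability T R) (Xs : nat -> {RV P >-> R}) : Prop :=
  mutually_independent Xs /\ forall i, same_law (Xs i) X.

Definition is_distribution_function (R : realType) d (T : measurableType d)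
    (P : probability T R) (X : {RV P >-> R}) (G : R -> R) : Prop :=
  forall x : R, cdf X x = (G x)%:E.

Definition has_bounded_continuous_density (R : realType) (G g : R -> R) : Prop :=
  [/\ forall x : R, 0 < x -> 0 <= g x,
      exists K, forall x : R, 0 < x -> g x <= K,
      forall x : R, 0 < x -> {for x, continuous g} &
      forall x : R, 0 < x ->
        (G x)%:E = (\int[lebesgue_measure]_(t in `]0%R, x]) (g t)%:E)%E].

Definition exponentially_distributed (R : realType) d (T : measurableType d)
    (P : probability T R) (X : {RV P >-> R}) (lambda : R) : Prop :=
  forall B : set R, measurable B ->
    distribution P X B = exponential_prob lambda B.

Definition penalized_card (R : realType) (xi : nat -> R) (n : nat)
    (A : {set 'I_n}) : R :=
  #|A|%:R
  - \sum_(p : 'I_n * 'I_n | val p.2 == (val p.1).+1)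
      xi p.1 * ((p.1 \in A) && (p.2 \in A))%:R.

(* The maximum is nonempty: it is seeded with the value at the empty set. *)
Definition max_penalized_card (R : realType) (xi : nat -> R) (n : nat) : R :=
  \big[Num.max/penalized_card xi (finset.set0 : {set 'I_n})]_(A : {set 'I_n})
    penalized_card xi A.

Definition cvg_L1 (R : realType) d (T : measurableType d)
    (P : probability T R) (Y : nat -> T -> R) (c : R) : Prop :=
  (forall n, Y n \in Lfun P 1%E) /\
  ('E_P[fun w => `|Y n w - c|%R])%E @[n --> \oo] --> 0%E.

(* Since G is a distribution function without atoms and G (1/2) > 0 in the
   situation of interest, the denominator does not vanish on [0, 1]. *)
Definition cdf_F (R : realType) (G : R -> R) (x : R) : R :=
  (1 - G (1 - x)) * G x / (1 - (1 - G x) * (1 - G (1 - x))).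

Definition boundary_triple (R : realType) (G : R -> R) d
    (T : measurableType d) (P : probability T R)
    (XL X XR : {RV P >-> R}) : Prop :=
  [/\ mutually_independent (tnth [tuple XL; X; XR]),
      is_distribution_function X G,
      forall w, 0 <= XL w <= 1 /\ 0 <= XR w <= 1 &
      forall x : R, 0 <= x <= 1 ->
        cdf XL x = (cdf_F G x)%:E /\ cdf XR x = (cdf_F G x)%:E].

Definition below_both (R : realType) d (T : measurableType d)
    (P : probability T R) (XL X XR : {RV P >-> R}) : set T :=
  [set w | X w < Num.min (XL w) (XR w)].

(* Stated in the extended reals, so that the expectation is finite. *)
Definition constant_formula (R : realType) (c : R) d (T : measurableType d)
    (P : probability T R) (XL X XR : {RV P >-> R}) : Prop :=
  c%:E = ((2^-1)%:E + (2^-1)%:E * P (below_both XL X XR)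
          - 'E_P[fun w => (X w * \1_(below_both XL X XR) w)%R])%E.

(* Main.v *)
(* Compare the best value over the sets that contain the last point with the
   best value over those that avoid it: the difference D_n follows the recursion
   D_(n+1) = 1 - min(xi_n, D_n) from D_0 = 1, and M_n is D_0 + ... + D_(n-1).

   The stationary law of this chain has distribution function F.  With
   phi = 1 - F(1 - .), which satisfies phi(s) + (1 - G s) phi(1 - s) = 1, and
   h(y) the integral of phi over [0, y], Fubini gives the Poisson equation
   E h(1 - min(xi, a)) = h(a) - a + h(1).  So M_n - n h(1) is, up to a bounded
   term, a martingale with increments bounded by 1; its fourth moment is at most
   4 n^2, which makes E (N_n / n)^4 summable and gives almost sure convergence,
   then L^1 convergence by boundedness.  Thus c = h(1), the stationary mean.

   For the formula, let A, B be independent stationary variables and V ~ G.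
   Then U = 1 - min(V, B) is a copy of A independent of A, so exchanging A and U
   in E[A; A + U > 1] gives E[A - 1 + min(V, B); min(V, B) < A] = 0.  Adding the
   same identity with A and B swapped, the integrands sum to
   A + B - 1 + (2 V - 1) 1(V < min(A, B)) off the null event A = B. *)
Require Import Defs.
From HB Require Import structures.
From mathcomp Require Import all_boot all_order all_algebra.
From mathcomp Require Import all_classical all_reals all_analysis.
From mathcomp Require Import measurable_realfun.
From mathcomp Require Import lra ring.
Import Order.TTheory GRing.Theory Num.Theory.
Import numFieldNormedType.Exports.
Set Implicit Arguments.
Unset Strict Implicit.
Unset Printing Implicit Defensive.

Local Open Scope classical_set_scope.
Local Open Scope ring_scope.

(** * The maximum as a sum along a recursion *)

(* With n + 1 points, the best value over the sets that contain the last point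
   minus the best value over those that avoid it. *)
Fixpoint gain (R : realType) (x : nat -> R) (n : nat) : R :=
  if n is k.+1 then 1 - Num.min (x k) (gain x k) else 1.

Lemma gain_itv (R : realType) (x : nat -> R) n :
  (forall i, 0 <= x i) -> 0 <= gain x n <= 1.
Proof.
move=> x0; elim: n => [|n /andP[D0 D1]] /=; first by rewrite ler01 lexx.
rewrite subr_ge0 ge_min D1 orbT /= lerBlDr lerDl le_min D0 andbT.
exact: x0.
Qed.

(** A set is coded by a boolean function on [nat], of which only the values below [n] are read; this
    allows induction on [n], which the dependent type ['I_n] hampers. *)
Definition penalized_sum (R : realType) (x : nat -> R) (f : nat -> bool)
    (n : nat) : R :=
  \sum_(i < n) (f i)%:R - \sum_(i < n.-1) x i * (f i && f i.+1)%:R.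

Lemma penalized_card_sum (R : realType) (x : nat -> R) (n : nat)
    (A : {set 'I_n}) (f : nat -> bool) :
  (forall i : 'I_n, f i = (i \in A)) ->
  penalized_card x A = penalized_sum x f n.
Proof.
move=> fA; congr (_ - _).
  rewrite -sum1_card natr_sum big_mkcond; apply: eq_bigr => i _.
  by rewrite fA; case: (i \in A).
rewrite (eq_bigl (fun p : 'I_n * 'I_n => true && (val p.2 == (val p.1).+1))) //.
rewrite -(pair_big_dep (fun _ : 'I_n => true)
  (fun i j : 'I_n => val j == (val i).+1)
  (fun i j : 'I_n => x i * ((i \in A) && (j \in A))%:R)) /=.
case: n A fA => [|n] A fA; first by rewrite !big_ord0.
(* The last index has no successor in ['I_n.+1], so its inner sum is empty. *)
rewrite big_ord_recr /= [X in _ + X]big_pred0 ?addr0; last first.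
  by move=> j /=; rewrite ltn_eqF.
apply: eq_bigr => i _ /=.
(* [lift ord0 i] has value [i + 1]: the inner sum has this single term. *)
rewrite (big_pred1 (lift ord0 i)) => [|j /=].
  by rewrite -!fA.
by rewrite -val_eqE.
Qed.

Lemma penalized_sumS (R : realType) (x : nat -> R) (f : nat -> bool) n :
  penalized_sum x f n.+2 =
  penalized_sum x f n.+1 + (f n.+1)%:R - x n * (f n && f n.+1)%:R.
Proof.
by rewrite /penalized_sum /= big_ord_recr /= [in X in _ - X]big_ord_recr /=; ring.
Qed.

Lemma eq_penalized_sum (R : realType) (x : nat -> R) (f g : nat -> bool) n :
  (forall i, (i < n)%N -> f i = g i) -> penalized_sum x f n = penalized_sum x g n.
Proof.
case: n => [|n] fg; first by rewrite /penalized_sum !big_ord0.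
congr (_ - _); first by apply: eq_bigr => i _; rewrite fg.
by apply: eq_bigr => i _; rewrite !fg // ltnS // ltnW.
Qed.

(** The right-hand side is the optimum over [n + 1] points once the last bit is prescribed. Keeping
    that bit in the bound closes the induction, as a new penalty involves no other earlier bit. *)
Lemma penalized_sum_le (R : realType) (x : nat -> R) (f : nat -> bool) n :
  (forall i, 0 <= x i) ->
  penalized_sum x f n.+1 <= \sum_(k < n) gain x k + gain x n * (f n)%:R.
Proof.
move=> x0; elim: n => [|n IH].
  by rewrite /penalized_sum /= big_ord1 !big_ord0 subr0 add0r mul1r.
have /andP[D0 D1] := gain_itv n x0.
rewrite penalized_sumS big_ord_recr /=.
move: IH D0 D1 (x0 n); set S := \sum_(k < n) _; set p := penalized_sum _ _ _.
set D := gain x n.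
by case: (f n) => /=; case: (f n.+1) => /=; case: (leP (x n) D) => *; lra.
Qed.

Lemma penalized_sum_attained (R : realType) (x : nat -> R) n (b : bool) :
  (forall i, 0 <= x i) ->
  exists2 f : nat -> bool, f n = b &
    penalized_sum x f n.+1 = \sum_(k < n) gain x k + gain x n * b%:R.
Proof.
move=> x0; elim: n b => [|n IH] b.
  exists (fun _ => b) => //.
  by rewrite /penalized_sum /= big_ord1 !big_ord0 subr0 add0r mul1r.
(* The optimal previous bit: take the point if the new one is absent, and otherwise exactly when the
   penalty does not exceed its gain. *)
have [f fn fE] := IH (~~ b || (x n <= gain x n)).
exists (fun i => if i == n.+1 then b else f i); first by rewrite eqxx.
rewrite penalized_sumS eqxx (ltn_eqF (ltnSn n)) fn.
rewrite (@eq_penalized_sum _ _ _ f) => [|i ilt]; last by rewrite ltn_eqF.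
rewrite fE big_ord_recr /=; case: b {fE fn} => /=; last first.
  by rewrite !mulr0 addr0 mulr1 subr0 addr0.
by case: (leP (x n) (gain x n)) => _ /=; lra.
Qed.

Lemma bigmax_seed_eq (R : realType) (I : finType) (F : I -> R) (i0 : I) (m : R) :
  (forall i, F i <= m) -> (exists i, F i = m) ->
  \big[Num.max/F i0]_i F i = m.
Proof.
move=> Fm [i Fi]; apply/le_anti/andP; split; first exact/bigmax_leP.
by rewrite -Fi; exact: (@le_bigmax _ _ _ (F i0) F i).
Qed.

Lemma max_penalized_card_sum_gain (R : realType) (x : nat -> R) n :
  (forall i, 0 <= x i) -> max_penalized_card x n = \sum_(k < n) gain x k.
Proof.
move=> x0; apply: bigmax_seed_eq => [A|].
  pose f i := if insub i is Some j then j \in A else false.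
  have fA (i : 'I_n) : f i = (i \in A).
    by rewrite /f valK.
  rewrite (penalized_card_sum x fA).
  case: n A f fA => [|n] A f fA; first by rewrite /penalized_sum !big_ord0 subr0.
  rewrite (le_trans (penalized_sum_le f n x0)) // big_ord_recr lerD2l.
  have /andP[D0 _] := gain_itv n x0.
  by case: (f n); rewrite ?mulr1 ?mulr0.
case: n => [|n].
  exists finset.set0.
  by rewrite (@penalized_card_sum _ _ _ _ xpred0) => [|[]//];
    rewrite /penalized_sum !big_ord0 subr0.
(* Containing the last point is optimal because gains are nonnegative; its gain is the final term of
   the sum. *)
have [f _ fE] := penalized_sum_attained n true x0.
exists (finset (fun i : 'I_n.+1 => f i)).
rewrite (@penalized_card_sum _ _ _ _ f) => [|i]; last by rewrite inE.
by rewrite fE mulr1 big_ord_recr.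
Qed.

(** * Independence *)

Section rectangles.
Context {d1 d2} {T1 : measurableType d1} {T2 : measurableType d2}
  {R : realType}.
Local Open Scope ereal_scope.

(** Rectangles form a generating family stable under intersection, and the total mass is finite. *)
Lemma measure_eq_on_rectangles (m1 m2 : {measure set (T1 * T2) -> \bar R}) :
  m1 setT < +oo ->
  (forall A B, measurable A -> measurable B -> m1 (A `*` B) = m2 (A `*` B)) ->
  forall C, measurable C -> m1 C = m2 C.
Proof.
move=> m1oo m12 C mC.
apply: (measure_unique [set A `*` B | A in measurable & B in measurable]
  (fun=> setT)) => //.
- exact: measurable_prod_measurableType.
- move=> _ _ [A mA [B mB <-]] [A' mA' [B' mB' <-]].
  exists (A `&` A'); first exact: measurableI.
  by exists (B `&` B'); [exact: measurableI|rewrite setXI].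
- by move=> _; exists setT => //; exists setT => //; rewrite setXTT.
- by rewrite bigcup_const //; exists 0%N.
- by move=> _ [A mA [B mB <-]]; exact: m12.
Qed.

End rectangles.

Lemma bounded_integrable {R : realType} d (T : measurableType d)
    (P : probability T R) (f : T -> R) (K : R) :
  measurable_fun setT f -> (forall z, `|f z| <= K) ->
  P.-integrable setT (EFin \o f).
Proof.
move=> mf fK; apply: measurable_bounded_integrable => //.
  by rewrite -ge0_fin_numE ?fin_num_measure.
exists K; split; first exact: num_real.
by move=> x Kx y _; apply: (le_trans (fK y)); exact: ltW.
Qed.

Lemma bounded_abse_integral_le {R : realType} d (T : measurableType d)
    (P : probability T R) (f : T -> R) (K : R) :
  measurable_fun setT f -> (forall z, `|f z| <= K) ->
  (`|\int[P]_w (f w)%:E| <= K%:E)%E.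
Proof.
move=> mf fK; have mEf : measurable_fun setT (EFin \o f) by exact/measurable_EFinP.
apply: le_trans (le_abse_integral P measurableT mEf) _.
have K0 : (0 <= K%:E)%E by rewrite lee_fin (le_trans (normr_ge0 _) (fK point)).
apply: (@le_trans _ _ (K%:E * P setT)%E); last by rewrite probability_setT mule1.
by apply: integral_le_bound => //; apply: aeW => w _ /=; rewrite lee_fin.
Qed.

Section independence.
Context {d d1 d2} {T : measurableType d} {T1 : measurableType d1}
  {T2 : measurableType d2} {R : realType} (P : probability T R).
Variables (Z : {mfun T >-> T1}) (X : {mfun T >-> T2}).
Local Open Scope ereal_scope.

Definition indep2 := forall A B, measurable A -> measurable B ->
  P (Z @^-1` A `&` X @^-1` B) = P (Z @^-1` A) * P (X @^-1` B).

Let mZX : measurable_fun setT (fun w => (Z w, X w)).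
Proof. exact: measurable_fun_pair. Qed.

Let ZX : {mfun T >-> (T1 * T2)%type} :=
  MeasurableFun.Pack (MeasurableFun.Class (isMeasurableFun.Build _ _ _ _ _ mZX)).

(** Both sides are finite measures in [C], the law of the pair restricted to [E] and its law scaled
    by [P E], so agreement on rectangles suffices. *)
Lemma indep_pair_event (E : set T) : measurable E ->
  (forall A B, measurable A -> measurable B ->
    P (Z @^-1` A `&` X @^-1` B `&` E) = P (Z @^-1` A `&` X @^-1` B) * P E) ->
  forall C, measurable C ->
    P ((fun w => (Z w, X w)) @^-1` C `&` E) =
    P ((fun w => (Z w, X w)) @^-1` C) * P E.
Proof.
move=> mE H C mC.
pose k : {nonneg R} := NngNum (fine_ge0 (measure_ge0 P E)).
have kE : (k%:num)%:E = P E by rewrite /= fineK ?fin_num_measure.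
have := @measure_eq_on_rectangles _ _ _ _ _
  (pushforward (mrestr P mE) ZX) (mscale k (pushforward P ZX)) _ _ C mC.
rewrite /= /mscale /pushforward /mrestr /= fineK ?fin_num_measure // muleC; apply.
  exact: mZX.
  exact: mZX.
  by rewrite preimage_setT setTI (@le_lt_trans _ _ 1) ?ltry // probability_le1.
by move=> A B mA mB; rewrite muleC; exact: H.
Qed.

(** Independence makes the joint law the product of the two laws; Fubini then applies on the product
    of the value spaces. *)
Let integral_indep2_bounded (f : T1 * T2 -> R) :
  indep2 -> measurable_fun setT f -> (exists K, forall z, (`|f z| <= K)%R) ->
  \int[P]_w (f (Z w, X w))%:E = \int[P]_w \int[P]_v (f (Z w, X v))%:E.
Proof.
move=> ind mf [K fK].
have prodE C : measurable C ->
    (distribution P Z \x distribution P X) C = distribution P ZX C.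
  by apply: product_measure_unique => A B mA mB; exact: ind.
transitivity (\int[distribution P ZX]_z (f z)%:E).
  rewrite integral_distribution //; first exact/measurable_EFinP.
  apply: (@bounded_integrable _ _ _ P (f \o ZX) K) => [|z]; last exact: fK.
  exact: (measurableT_comp mf mZX).
transitivity (\int[distribution P Z \x distribution P X]_z (f z)%:E).
  by apply: eq_measure_integral => C mC _; exact/esym/prodE.
have if12 : (distribution P Z \x distribution P X).-integrable setT (EFin \o f).
  by apply: (@bounded_integrable _ _ _ (distribution P Z \x distribution P X)%E f K).
have mfz z : measurable_fun setT (fun x => f (z, x)).
  exact: measurableT_comp mf (measurable_pair1 _).
rewrite -(@integral12_prod_meas1 _ _ _ _ _ (distribution P Z) (distribution P X) _ if12).
rewrite /fubini_F integral_distribution.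
- apply: eq_integral => w _ /=.
  rewrite integral_distribution //; first exact/measurable_EFinP.
  apply: (@bounded_integrable _ _ _ P (fun v => f (Z w, X v)) K) => [|v]; last exact: fK.
  by apply: (measurableT_comp (mfz _)).
- exact: (measurable_fubini_F if12).
- apply: (@le_integrable _ _ _ P _ _ _ (cst K%:E)) => //.
  + apply: measurableT_comp => //; exact: (measurable_fubini_F if12).
  + move=> w _ /=; rewrite (ger0_norm (le_trans (normr_ge0 _) (fK point))).
    exact: (@bounded_abse_integral_le _ _ _ (distribution P X) _ _ (mfz _)).
  + exact: finite_measure_integrable_cst.
Qed.

(** Here [f] is bounded only on the values taken by [Z] and [X]; truncating it to [[-K, K]] changes
    nothing there and reduces to the bounded case. *)
Lemma integral_indep2 (f : T1 * T2 -> R) (K : R) :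
  indep2 -> measurable_fun setT f -> (forall w v, (`|f (Z w, X v)| <= K)%R) ->
  \int[P]_w (f (Z w, X w))%:E = \int[P]_w \int[P]_v (f (Z w, X v))%:E.
Proof.
move=> ind mf fK; pose g z := Num.max (- K)%R (Num.min K (f z)).
have gE w v : f (Z w, X v) = g (Z w, X v).
  by have := fK w v; rewrite ler_norml /g => /andP[? ?]; rewrite min_r ?max_r.
under eq_integral do rewrite gE.
under [RHS]eq_integral do under eq_integral do rewrite gE.
apply: integral_indep2_bounded => //.
  by apply: measurable_maxr => //; exact: measurable_minr.
have K0 : (0 <= K)%R by rewrite (le_trans (normr_ge0 _) (fK point point)).
exists K => z; rewrite ler_norml /g le_max lexx /= ge_max ge_min lexx /= andbT.
lra.
Qed.

End independence.

Section markov_chain.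
Context {d d1} {T : measurableType d} {T1 : measurableType d1}
  {R : realType} (P : probability T R).
Variables (x : nat -> {RV P >-> R}) (Z : nat -> {mfun T >-> T1}).
Variables (F : T1 * R -> T1) (z0 : T1).
Hypothesis x_indep : mutually_independent x.
Hypothesis mF : measurable_fun setT F.
Hypothesis Z0 : forall w, Z 0%N w = z0.
Hypothesis ZS : forall n w, Z n.+1 w = F (Z n w, x n w).
Local Open Scope ereal_scope.

Let measurable_cap (s : seq nat) (B : nat -> set R) :
  (forall i, measurable (B i)) ->
  measurable (\bigcap_(i in [set` s]) (x i @^-1` B i)).
Proof.
move=> mB; apply: fin_bigcap_measurable => [|i _]; first exact: finite_seq.
exact: measurable_funPTI.
Qed.

(* The future variables are included so that the induction goes through: one step
   of the chain consumes the first of them. *)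
Lemma chain_indep_future n (A : set T1) (s : seq nat) (B : nat -> set R) :
  measurable A -> uniq s -> (forall i, measurable (B i)) ->
  (forall i, i \in s -> (n <= i)%N) ->
  P (Z n @^-1` A `&` \bigcap_(i in [set` s]) (x i @^-1` B i)) =
  P (Z n @^-1` A) * \prod_(i <- s) P (x i @^-1` B i).
Proof.
elim: n A s B => [|n IH] A s B mA us mB ns.
  have [Az|Az] := pselect (A z0).
    have -> : Z 0%N @^-1` A = setT.
      by rewrite -subTset => w _ /=; rewrite Z0.
    by rewrite setTI probability_setT mul1e x_indep.
  have -> : Z 0%N @^-1` A = set0 by rewrite -subset0 => w /=; rewrite Z0.
  by rewrite set0I measure0 mul0e.
have mE := measurable_cap s mB.
(* The event on [Z n.+1] is an event on the pair [(Z n, x n)], so it may be replaced by a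
   rectangle. *)
rewrite -x_indep // (_ : Z n.+1 @^-1` A =
    (fun w => (Z n w, x n w)) @^-1` (F @^-1` A)); last first.
  by apply/seteqP; split => w /=; rewrite ZS.
apply: indep_pair_event => // [A' B' mA' mB'|]; last first.
  by rewrite -[_ @^-1` _]setTI; exact: mF.
(* Prescribes [B'] at index [n] and [B] on [s]. There is no clash: the indices in [s] are at least
   [n.+1]. *)
pose B'' i := if i == n then B' else B i.
have mB'' i : measurable (B'' i) by rewrite /B''; case: ifP.
have nns : n \notin s by apply/negP => /ns; rewrite ltnn.
have sn i : i \in s -> B'' i = B i.
  by move=> si; rewrite /B''; case: eqP si nns => // -> ->.
have E1 := IH A' [:: n] B'' mA' isT mB'' _.
have E2 := IH A' (n :: s) B'' mA' _ mB'' _.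
rewrite bigcap_seq !big_seq1 in E1.
rewrite bigcap_seq !big_cons -bigcap_seq in E2.
have cap : \bigcap_(i in [set` s]) (x i @^-1` B'' i) =
   \bigcap_(i in [set` s]) (x i @^-1` B i).
  by apply: eq_bigcapr => i /= si; rewrite sn.
rewrite cap {1}/B'' eqxx in E2; rewrite /B'' eqxx in E1.
rewrite -setIA E2 /=; last 2 first.
- by rewrite nns us.
- by move=> i; rewrite inE => /predU1P[->//|/ns/ltnW].
rewrite E1; last by move=> i; rewrite inE => /eqP ->.
rewrite x_indep // -muleA /B'' eqxx; congr (_ * (_ * _)).
by rewrite big_seq [RHS]big_seq; apply: eq_bigr => i si; rewrite -/(B'' i) sn.
Qed.

Lemma chain_indep2 n : indep2 P (Z n) (x n).
Proof.
move=> A B mA mB; have := @chain_indep_future n A [:: n] (fun=> B).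
by rewrite bigcap_seq !big_seq1; apply => // i; rewrite inE => /eqP ->.
Qed.

End markov_chain.

(** * The stationary law and the Poisson equation *)

Lemma continuous_integrable_segment (R : realType) (f : R -> R) (a b : R) :
  continuous f -> lebesgue_measure.-integrable `[a, b] (EFin \o f).
Proof.
move=> cf; apply: continuous_compact_integrable; first exact: segment_compact.
exact: continuous_subspaceT.
Qed.

(* The tail 1 - F of the stationary law, reflected by s |-> 1 - s. *)
Definition message_tail (R : realType) (G : R -> R) (s : R) : R :=
  G s / (G s + (1 - G s) * G (1 - s)).

Definition atomless_cdf (R : realType) (G : R -> R) : Prop :=
  [/\ {homo G : x y / x <= y}, forall x, 0 <= G x <= 1,
      forall x, x <= 0 -> G x = 0, continuous G & 0 < G 2^-1].

Section message_tail.
Context {R : realType} (G : R -> R).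
Hypothesis GP : atomless_cdf G.
Local Notation phi := (message_tail G).
Let den s := G s + (1 - G s) * G (1 - s).

Let G_nd : {homo G : x y / x <= y}. Proof. by case: GP. Qed.
Let G01 x : 0 <= G x <= 1. Proof. by case: GP. Qed.
Let G_le0 x : x <= 0 -> G x = 0. Proof. by case: GP => _ _ + _ _; apply. Qed.
Let G_cont : continuous G. Proof. by case: GP. Qed.
Let Ghalf : 0 < G 2^-1. Proof. by case: GP. Qed.

(** One of [s] and [1 - s] is at least 1/2, where [G] is positive. *)
Let den_gt0 s : 0 < den s.
Proof.
rewrite /den; have /andP[a0 a1] := G01 s; have /andP[b0 b1] := G01 (1 - s).
have [s_ge|s_lt] := leP 2^-1 s.
  have : 0 < G s by apply: lt_le_trans Ghalf _; exact: G_nd.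
  nra.
have : 0 < G (1 - s) by apply: lt_le_trans Ghalf _; apply: G_nd; lra.
nra.
Qed.

Let den_sym s : den (1 - s) = den s.
Proof. by rewrite /den subKr; ring. Qed.

Lemma message_tail_itv s : 0 <= phi s <= 1.
Proof.
have /andP[a0 a1] := G01 s; have /andP[b0 b1] := G01 (1 - s).
rewrite /message_tail -/(den s); apply/andP; split.
  by rewrite divr_ge0 // ltW // den_gt0.
by rewrite ler_pdivrMr ?den_gt0 // mul1r lerDl mulr_ge0 // subr_ge0.
Qed.

(** The denominator is invariant under [s |-> 1 - s], so the two fractions add up. Read at [1 - s],
    this is the stationarity of [F] under [b |-> 1 - min(V, b)] with [V] of law [G]. *)
Lemma message_tail_fixpoint s : phi s + (1 - G s) * phi (1 - s) = 1.
Proof.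
rewrite /message_tail -/(den s) -/(den (1 - s)) den_sym.
rewrite mulrA -mulrDl divff // gt_eqF //; exact: den_gt0.
Qed.

Lemma cdf_F_message_tail s : cdf_F G s = 1 - phi (1 - s).
Proof.
rewrite /cdf_F /message_tail -/(den (1 - s)) den_sym.
have -> : 1 - (1 - G s) * (1 - G (1 - s)) = den s by rewrite /den; ring.
have d0 := lt0r_neq0 (den_gt0 s).
by move: d0; rewrite /den => d0; field.
Qed.

(** After cross-multiplication and cancellation of [G x * G y], what remains is a comparison of
    products, monotone factor by factor. *)
Lemma message_tail_nd : {homo phi : x y / x <= y}.
Proof.
move=> x y xy; rewrite /message_tail -/(den x) -/(den y) ler_pdivrMr ?den_gt0 // mulrAC.
rewrite ler_pdivlMr ?den_gt0 //.
have /andP[a0 a1] := G01 x; have /andP[b0 b1] := G01 (1 - x).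
have /andP[c0 c1] := G01 y; have /andP[d0 d1] := G01 (1 - y).
have ac := G_nd xy; have db : G (1 - y) <= G (1 - x) by apply: G_nd; lra.
rewrite !mulrDr [G y * G x]mulrC lerD2l.
apply: ler_pM => //; first by rewrite mulr_ge0 // subr_ge0.
by apply: ler_pM => //; rewrite ?subr_ge0 // lerD2l lerN2.
Qed.

Lemma message_tail_le0 s : s <= 0 -> phi s = 0.
Proof. by move=> s0; rewrite /message_tail G_le0 // mul0r. Qed.

Lemma message_tail_ge1 s : 1 <= s -> phi s = 1.
Proof.
move=> s1; have := message_tail_fixpoint s.
by rewrite [phi (1 - s)]message_tail_le0 ?subr_le0 // mulr0 addr0.
Qed.

Lemma message_tail_continuous : continuous phi.
Proof.
move=> s; have G1 : {for s, continuous (fun t : R => G (1 - t) : R)}.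
  apply: (@continuous_comp _ _ _ (fun t : R => 1 - t) G); last exact: G_cont.
  by apply: cvgB; [exact: cvg_cst|exact: cvg_id].
apply: cvgM; first exact: G_cont.
apply: cvgV; first by rewrite gt_eqF // den_gt0.
apply: cvgD; first exact: G_cont.
apply: cvgM; last exact: G1.
by apply: cvgB; [exact: cvg_cst|exact: G_cont].
Qed.

Lemma message_tail_onem_continuous : continuous (fun s : R => phi (1 - s) : R).
Proof.
move=> s; apply: (@continuous_comp _ _ _ (fun t : R => 1 - t) phi).
  by apply: cvgB; [exact: cvg_cst|exact: cvg_id].
exact: message_tail_continuous.
Qed.

Lemma stationary_cdf_continuous : continuous (fun s : R => 1 - phi (1 - s) : R).
Proof.
by move=> s; apply: cvgB; [exact: cvg_cst|exact: message_tail_onem_continuous].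
Qed.

(* Solves the Poisson equation of the recursion of [gain]; its value at 1 is the
   limit constant. *)
Definition potential (y : R) : R := \int[lebesgue_measure]_(s in `[0, y]) phi s.

Let phi_int (a b : R) : lebesgue_measure.-integrable `[a, b] (EFin \o phi).
Proof. exact/continuous_integrable_segment/message_tail_continuous. Qed.

Lemma potential0 : potential 0 = 0.
Proof. by rewrite /potential set_itv1 Rintegral_set1. Qed.

Lemma potentialB a b : 0 <= a <= b ->
  potential b - potential a = \int[lebesgue_measure]_(s in `]a, b]) phi s.
Proof.
move=> /andP[a0 ab]; rewrite /potential Rintegral_itvB // bnd_simp //.
Qed.

Lemma potential_nd a b : 0 <= a <= b -> potential a <= potential b.
Proof.
move=> ab; rewrite -subr_ge0 potentialB //.
by apply: Rintegral_ge0 => s _; case/andP: (message_tail_itv s).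
Qed.

Lemma potential_measurable : measurable_fun setT potential.
Proof.
apply: nondecreasing_measurable => // a b ab.
have [a0|a0] := leP 0 a; first by rewrite potential_nd // a0.
(* For negative [a] the interval of integration is empty. *)
have -> : potential a = 0.
  by rewrite /potential set_itv_ge ?bnd_simp -?ltNge // Rintegral_set0.
by apply: Rintegral_ge0 => s _; case/andP: (message_tail_itv s).
Qed.

Lemma potential_le1 : potential 1 <= 1.
Proof.
rewrite /potential.
apply: (@le_trans _ _ (\int[lebesgue_measure]_(s in `[0%R, 1%R]) (1 : R))).
  apply: le_Rintegral => //.
  - by apply: continuous_integrable_segment => x; exact: cvg_cst.
  - by move=> s _; case/andP: (message_tail_itv s).
by rewrite Rintegral_cst //= mul1r lebesgue_measure_itv /= lte_fin ltr01 /= subr0.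
Qed.

Lemma potential_itv y : 0 <= y <= 1 -> 0 <= potential y <= 1.
Proof.
move=> /andP[y0 y1]; rewrite -{1}potential0 potential_nd ?lexx //=.
by rewrite (le_trans _ potential_le1) // potential_nd // y0.
Qed.

(** The substitution [s |-> 1 - s] carries [[0, m]] to [[1 - m, 1]], where the integral is an
    increment of the potential. *)
Lemma potential_onem m : 0 <= m <= 1 ->
  potential (1 - m) =
  potential 1 - \int[lebesgue_measure]_(s in `[0, m]) phi (1 - s).
Proof.
move=> /andP[m0 m1]; have mP : 0 <= m <= 1 by rewrite m0.
rewrite (@Rintegration_by_substitution_onem _ (fun s => phi (1 - s))) //; last first.
  by apply: continuous_subspaceT => x; exact: message_tail_onem_continuous.
under eq_Rintegral do rewrite /unstable.onem subKr.
rewrite -Rintegral_itv_obnd_cbnd; last first.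
  by apply: integrableS (phi_int (1 - m) 1) => //; apply: subset_itv_oc_cc.
rewrite -potentialB; last by rewrite /unstable.onem subr_ge0 m1 lerBlDr lerDl.
by rewrite subKr.
Qed.

Lemma potential1_onem :
  potential 1 = \int[lebesgue_measure]_(s in `[0, 1]) phi (1 - s).
Proof.
have := @potential_onem 1; rewrite subrr potential0 ler01 lexx => /(_ isT).
by move/eqP; rewrite eq_sym subr_eq0 => /eqP.
Qed.

End message_tail.

Lemma mem_set_bool (T : Type) (p : T -> bool) (x : T) :
  (x \in [set y | p y]) = p x.
Proof. by apply/idP/idP => [/set_mem|px] //; exact: mem_set. Qed.

Section comparison_sets.
Context {R : realType} d (T : measurableType d) (f g : T -> R).
Hypotheses (mf : measurable_fun setT f) (mg : measurable_fun setT g).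

Lemma measurable_ltr_set : measurable [set z | f z < g z].
Proof.
by have := measurable_fun_ltr mf mg measurableT (Y := [set true]) I; rewrite setTI.
Qed.

Lemma measurable_ler_set : measurable [set z | f z <= g z].
Proof.
by have := measurable_fun_ler mf mg measurableT (Y := [set true]) I; rewrite setTI.
Qed.

End comparison_sets.

(** Continuity of [H] at [t] rules out an atom: the open ray contains the closed ray ending at
    [t - r / 2], whose mass is within [e] of [H t]. *)
Lemma probability_lt (R : realType) d (T : measurableType d)
    (P : probability T R) (X : {RV P >-> R}) (H : R -> R) (t : R) :
  is_distribution_function X H -> {for t, continuous H} ->
  P [set w | X w < t] = (H t)%:E.
Proof.
move=> XH Ht.
have cdfE s : P [set w | X w <= s] = (H s)%:E.
  by rewrite -XH.
have mlt : measurable [set w | X w < t].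
  exact: (measurable_ltr_set (measurable_funPT X) (measurable_cst t)).
have mle s : measurable [set w | X w <= s].
  exact: (measurable_ler_set (measurable_funPT X) (measurable_cst s)).
apply/le_anti/andP; split.
  rewrite -cdfE; apply: le_measure; rewrite ?inE //.
  by move=> w /= /ltW.
apply/lee_addgt0Pr => e e0.
have /(@cvgrPdist_lt _ R^o)/(_ _ e0)[r /= r0 rH] := Ht.
have Hs : H t <= H (t - r / 2) + e.
  have : `|H t - H (t - r / 2)| < e.
    by apply: rH; rewrite /= subKr gtr0_norm; lra.
  by move/ltr_normlW; lra.
rewrite (@le_trans _ _ ((H (t - r / 2))%:E + e%:E)%E) ?lee_fin // leeD2r //.
rewrite -cdfE; apply: le_measure; rewrite ?inE //.
by move=> w /= wle; apply: (le_lt_trans wle); lra.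
Qed.

Lemma probability_ge (R : realType) d (T : measurableType d)
    (P : probability T R) (X : {RV P >-> R}) (H : R -> R) (t : R) :
  is_distribution_function X H -> {for t, continuous H} ->
  P [set w | t <= X w] = (1 - H t)%:E.
Proof.
move=> XH Ht; rewrite (_ : [set w | t <= X w] = ~` [set w | X w < t]).
  rewrite probability_setC ?(probability_lt XH) //.
  exact: (measurable_ltr_set (measurable_funPT X) (measurable_cst t)).
by apply/seteqP; split => w /=; rewrite leNgt => /negP.
Qed.

(** * The Poisson equation *)

Section poisson_equation.
Context {R : realType} (G : R -> R).
Hypothesis GP : atomless_cdf G.
Context d (T : measurableType d) (P : probability T R) (X : {RV P >-> R}).
Hypotheses (X_ge0 : forall w, 0 <= X w) (XG : is_distribution_function X G).
Local Notation phi := (message_tail G).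
Local Notation mu := (@lebesgue_measure R).
Let GR := measurableTypeR R.

Let G_cont : continuous G. Proof. by case: GP. Qed.
Let phi_itv s : 0 <= phi s <= 1. Proof. exact: message_tail_itv. Qed.

Let S : set (T * GR) := [set z | z.2 <= X z.1].
Let mS : measurable S.
Proof.
apply: (@measurable_ler_set R _ _ (fun z : T * GR => z.2 : R) (fun z => X z.1)).
  exact: measurable_snd.
exact: measurableT_comp.
Qed.

Let psi (a s : R) : R := phi (1 - s) * \1_(`[0%R, a]%classic : set R) s.

Let mpsi a : measurable_fun setT (psi a : GR -> R).
Proof.
apply: measurable_funM.
  apply: (@measurableT_comp _ _ _ _ _ _ phi).
    apply: continuous_measurable_fun; exact: message_tail_continuous.
  exact: measurable_funB.
exact: measurable_indic.
Qed.

Let integral_psi (a : R) :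
  (\int[mu]_(s in `[0%R, a]) (phi (1 - s))%:E = \int[mu]_s (psi a s)%:E)%E.
Proof.
rewrite [LHS]integral_mkcond; apply: eq_integral => s _.
by rewrite patchE /psi indicE; case: ifP => _ /=; rewrite ?mulr1 ?mulr0.
Qed.

(** Tonelli: integrating first over the sample space turns the indicator of [s <= X] into [1 - G s],
    and [(1 - G s) * phi (1 - s) = 1 - phi s] by the fixed-point equation. *)
Lemma integral_message_tail_min (a : R) :
  (\int[P]_w \int[mu]_(s in `[0%R, Num.min (X w) a]) (phi (1 - s))%:E =
   \int[mu]_(s in `[0%R, a]) (1 - phi s)%:E)%E.
Proof.
pose f (z : T * GR) := (psi a z.2 * \1_S z)%:E.
have f0 z : (0 <= f z)%E.
  rewrite lee_fin mulr_ge0 // mulr_ge0 //.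
  by case/andP: (phi_itv (1 - z.2)).
have mf : measurable_fun setT f.
  apply/measurable_EFinP; apply: measurable_funM; last exact: measurable_indic.
  exact: (measurableT_comp (mpsi a)).
have := @fubini_tonelli _ _ _ _ R P mu f mf f0.
rewrite (eq_integral (fun w =>
    (\int[mu]_(s in `[0%R, Num.min (X w) a]) (phi (1 - s))%:E)%E)); last first.
  move=> w _; rewrite integral_psi; apply: eq_integral => s _.
  rewrite /f /psi /= -mulrA; congr (_ * _)%:E; rewrite !indicE mem_set_bool -natrM mulnb.
  rewrite !mem_setE !in_itv /= le_min.
  by case: (0 <= s); case: (s <= a); rewrite ?andbT ?andbF.
move=> ->; rewrite [RHS]integral_mkcond; apply: eq_integral => s _.
rewrite /fubini_G patchE /f /=.
rewrite (eq_integral (fun w => (psi a s)%:E * (\1_[set v | s <= X v] w)%:E)%E); last first.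
  by move=> w _; rewrite EFinM !indicE !mem_set_bool.
rewrite ge0_integralZl //=; last 2 first.
- apply/measurable_EFinP; apply: measurable_indic.
  exact: (measurable_ler_set (measurable_cst s) (measurable_funPT X)).
- by rewrite lee_fin mulr_ge0 //; case/andP: (phi_itv (1 - s)).
rewrite integral_indic //; last first.
  exact: (measurable_ler_set (measurable_cst s) (measurable_funPT X)).
rewrite setIT [X in (_ * X)%E](probability_ge XG (@G_cont s)).
rewrite /psi indicE; case: ifP => _; rewrite ?mulr1 ?mulr0 ?mul0e //.
rewrite -EFinM mulrC; congr (_%:E).
by have := message_tail_fixpoint GP s; lra.
Qed.

(** By [potential_onem] the deficit [h(1) - h(1 - min(X, a))] is the inner integral of the previous
    lemma, so its mean is the integral of [1 - phi] over [[0, a]], that is [a - h(a)]. *)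
Lemma poisson_equation (a : R) : 0 <= a <= 1 ->
  \int[P]_w potential G (1 - Num.min (X w) a) =
  potential G a - a + potential G 1.
Proof.
move=> /andP[a0 a1].
have min01 w : 0 <= Num.min (X w) a <= 1.
  by rewrite le_min X_ge0 a0 ge_min a1 orbT.
have min01' w : 0 <= 1 - Num.min (X w) a <= 1.
  by case/andP: (min01 w) => ? ?; apply/andP; split; lra.
have ipot : P.-integrable setT
    (EFin \o (fun w => potential G (1 - Num.min (X w) a))).
  apply: (@bounded_integrable _ _ _ P _ 1) => [|w].
    apply: (measurableT_comp (potential_measurable GP)).
    apply: measurable_funB => //; exact: measurable_minr.
  by have /andP[p0 p1] := potential_itv GP (min01' w); rewrite ger0_norm.
have icst (c : R) : P.-integrable setT (EFin \o (fun=> c)).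
  exact: (@bounded_integrable _ _ _ P _ `|c|).
suff : \int[P]_w (potential G 1 - potential G (1 - Num.min (X w) a)) =
       a - potential G a.
  by rewrite RintegralB // Rintegral_cst // [X in fine X]probability_setT mulr1; lra.
transitivity (\int[mu]_(s in `[0, a]) (1 - phi s)).
  rewrite /Rintegral -integral_message_tail_min; congr fine.
  apply: eq_integral => w _; rewrite potential_onem // subKr fineK //.
  apply: integrable_fin_num => //.
  exact/continuous_integrable_segment/message_tail_onem_continuous.
rewrite RintegralB //.
- rewrite Rintegral_cst //= mul1r lebesgue_measure_itv /= lte_fin.
  by case: ltgtP a0 => //= [_ _|<- _]; rewrite ?subr0.
- by apply: continuous_integrable_segment => x; exact: cvg_cst.
- exact/continuous_integrable_segment/message_tail_continuous.
Qed.

End poisson_equation.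

(** * Martingale and law of large numbers *)

Section gain_martingale.
Context {R : realType} (G : R -> R).
Hypothesis GP : atomless_cdf G.
Context d (T : measurableType d) (P : probability T R) (x : nat -> {RV P >-> R}).
Hypothesis x_indep : mutually_independent x.
Hypothesis x_ge0 : forall n w, 0 <= x n w.
Hypothesis xG : forall n, is_distribution_function (x n) G.

Local Notation h := (potential G).
Local Notation c := (potential G 1).
Let D n w := gain (fun i => x i w) n.

(** By the Poisson equation, the conditional mean of [h (D n.+1)] given [D n = a]. *)
Let drift (a : R) : R := h a - a + c.

Let D01 n w : 0 <= D n w <= 1.
Proof. exact: gain_itv. Qed.

Let onem_min01 (y a : R) : 0 <= y -> 0 <= a <= 1 -> 0 <= 1 - Num.min y a <= 1.
Proof.
move=> y0 /andP[a0 a1]; rewrite subr_ge0 ge_min a1 orbT /=.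
by rewrite lerBlDr lerDl le_min y0.
Qed.

Let h_measurable : measurable_fun setT h := potential_measurable GP.

Let drift01 (a : R) : 0 <= a <= 1 -> 0 <= drift a <= 1.
Proof.
move=> a01; rewrite /drift -(poisson_equation GP (x_ge0 0%N) (xG 0%N) a01).
have hw w := potential_itv GP (onem_min01 (x_ge0 0%N w) a01).
rewrite Rintegral_ge0 => [/=|w _]; last by case/andP: (hw w).
apply: (@le_trans _ _ (\int[P]_w (1 : R))).
  apply: le_Rintegral => //.
  - apply: (@bounded_integrable _ _ _ P _ 1) => [|w].
      apply: (measurableT_comp h_measurable).
      apply: measurable_funB => //; exact: measurable_minr.
    by case/andP: (hw w) => ? ?; rewrite ger0_norm.
  - exact: (@bounded_integrable _ _ _ P _ `|1|).
  - by move=> w _; case/andP: (hw w).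
by rewrite Rintegral_cst // [X in fine X]probability_setT mulr1.
Qed.

(** The martingale is carried along with the gain, so that the pair is a Markov chain driven by [x]
    and is independent of the next variable. *)
Let step (z : R * R * R) : R * R :=
  (z.1.1 + (h (1 - Num.min z.2 z.1.2) - drift z.1.2), 1 - Num.min z.2 z.1.2).

Let mgain_step : measurable_fun setT
  (fun z : R * R * R => h (1 - Num.min z.2 z.1.2) - drift z.1.2).
Proof.
have m12 : measurable_fun setT (fun z : R * R * R => z.1.2).
  exact: measurableT_comp measurable_snd measurable_fst.
apply: measurable_funB.
  apply: (measurableT_comp h_measurable).
  by apply: measurable_funB => //; apply: measurable_minr.
rewrite /drift; apply: measurable_funD => //; apply: measurable_funB => //.
exact: (measurableT_comp h_measurable).
Qed.

Let mstep : measurable_fun setT step.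
Proof.
apply: measurable_fun_pair.
  apply: measurable_funD; last exact: mgain_step.
  exact: measurableT_comp measurable_fst measurable_fst.
apply: measurable_funB => //; apply: measurable_minr => //.
exact: measurableT_comp measurable_snd measurable_fst.
Qed.

Let state n w : R * R :=
  iteri n (fun k z => step (z, x k w)) (0, 1).

Let mstate n : measurable_fun setT (state n).
Proof.
elim: n => [|n IH] /=; first exact: measurable_cst.
apply: (measurableT_comp mstep); exact: measurable_fun_pair.
Qed.

Let Z n : {mfun T >-> (R * R)%type} :=
  MeasurableFun.Pack (MeasurableFun.Class (isMeasurableFun.Build _ _ _ _ _ (mstate n))).

(* By the Poisson equation its increments are [h (D n.+1)] minus the conditional
   mean of that variable given the past. *)
Definition gain_martingale n w : R :=
  \sum_(k < n) (D k w - c) + h (D n w) - c.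

Local Notation N := gain_martingale.

Let stateE n w : state n w = (N n w, D n w).
Proof.
elim: n => [|n IH] /=; first by rewrite /N big_ord0 add0r subrr.
rewrite IH /step /=; congr (_, _).
by rewrite /N big_ord_recr /= /drift; ring.
Qed.

Let incr n w := h (D n.+1 w) - drift (D n w).

Let NS n w : N n.+1 w = N n w + incr n w.
Proof. by rewrite /N big_ord_recr /= /incr /drift; ring. Qed.

Lemma gain_martingale_measurable n : measurable_fun setT (N n).
Proof.
rewrite (_ : N n = fst \o state n); last by apply/funext => w /=; rewrite stateE.
exact: measurableT_comp.
Qed.

Let mN := gain_martingale_measurable.

Let mincr n : measurable_fun setT (incr n).
Proof.
rewrite (_ : incr n = fun w => N n.+1 w - N n w); first exact: measurable_funB.
by apply/funext => w; rewrite NS; ring.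
Qed.

Let incr_le1 n w : `|incr n w| <= 1.
Proof.
rewrite /incr ler_norml.
have /andP[? ?] := drift01 (D01 n w); have /andP[? ?] := potential_itv GP (D01 n.+1 w).
by apply/andP; split; lra.
Qed.

Lemma gain_martingale_bound n w : `|N n w| <= n%:R.
Proof.
elim: n => [|n IH]; first by rewrite /N big_ord0 add0r subrr normr0.
rewrite NS (le_trans (ler_normD _ _)) // -natr1 lerD //.
Qed.

Let N_pow_bound n k w : `|N n w ^+ k| <= n%:R ^+ k.
Proof. by rewrite normrX lerXn2r ?nnegrE // gain_martingale_bound. Qed.

Let iN n k : P.-integrable setT (EFin \o (fun w => N n w ^+ k)).
Proof.
apply: (@bounded_integrable _ _ _ P _ (n%:R ^+ k)) => //.
exact: measurable_funX.
Qed.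

Let iNm n k : P.-integrable setT (EFin \o (fun w => N n w ^+ k * incr n w)).
Proof.
apply: (@bounded_integrable _ _ _ P _ (n%:R ^+ k)) => [|w].
  apply: measurable_funM => //; exact: measurable_funX.
by rewrite normrM -[leRHS]mulr1 ler_pM.
Qed.

(** As [x n] is independent of the pair [(N n, D n)], the integral can be iterated; with the pair
    frozen, the increment has mean zero by the Poisson equation. *)
Let gain_martingale_orthogonal n k : \int[P]_w (N n w ^+ k * incr n w) = 0.
Proof.
pose f (z : R * R * R) := z.1.1 ^+ k * (h (1 - Num.min z.2 z.1.2) - drift z.1.2).
have mf : measurable_fun setT f.
  apply: measurable_funM => //; apply: measurable_funX.
  exact: measurableT_comp measurable_fst measurable_fst.
have fE w v : f (Z n w, x n v) =
    N n w ^+ k * (h (1 - Num.min (x n v) (D n w)) - drift (D n w)).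
  by rewrite /f /= stateE.
have inc1 w v : `|h (1 - Num.min (x n v) (D n w)) - drift (D n w)| <= 1.
  rewrite ler_norml; have /andP[? ?] := drift01 (D01 n w).
  have /andP[? ?] := potential_itv GP (onem_min01 (x_ge0 n v) (D01 n w)).
  by apply/andP; split; lra.
have ind : indep2 P (Z n) (x n).
  by apply: (@chain_indep2 _ _ _ _ _ P x Z step (0, 1)).
have fK w v : `|f (Z n w, x n v)| <= n%:R ^+ k.
  by rewrite fE normrM -[leRHS]mulr1 ler_pM.
rewrite (@eq_Rintegral _ _ _ _ _ (fun w => f (Z n w, x n w))) => [|w _]; last by rewrite fE.
rewrite /Rintegral (integral_indep2 ind mf fK) integral0_eq // => w _.
under eq_integral do rewrite fE.
have ih : P.-integrable setT (EFin \o (fun v => h (1 - Num.min (x n v) (D n w)))).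
  apply: (@bounded_integrable _ _ _ P _ 1) => [|v].
    apply: (measurableT_comp h_measurable).
    apply: measurable_funB => //; exact: measurable_minr.
  by have /andP[? ?] := potential_itv GP (onem_min01 (x_ge0 n v) (D01 n w)); rewrite ger0_norm.
have id : P.-integrable setT (EFin \o (fun v : T => drift (D n w))).
  exact: (@bounded_integrable _ _ _ P _ `|drift (D n w)|).
have idiff : P.-integrable setT (EFin \o (fun v =>
     h (1 - Num.min (x n v) (D n w)) - drift (D n w))).
  apply: (@bounded_integrable _ _ _ P _ 1) => // ; apply: measurable_funB => //.
  exact/measurable_EFinP/(measurable_int P ih).
under eq_integral do rewrite EFinM.
rewrite integralZl //.
suff : \int[P]_v (h (1 - Num.min (x n v) (D n w)) - drift (D n w)) = 0.
  rewrite /Rintegral => H; rewrite -[X in (_ * X)%E]fineK ?integrable_fin_num //.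
  by rewrite H mule0.
rewrite RintegralB // Rintegral_cst // [X in _ * fine X]probability_setT mulr1.
by rewrite (poisson_equation GP (x_ge0 n) (xG n) (D01 n w)) subrr.
Qed.

Let icst (r : R) : P.-integrable setT (EFin \o (fun=> r)).
Proof. exact: (@bounded_integrable _ _ _ P _ `|r|). Qed.

Let iD (f g : T -> R) : P.-integrable setT (EFin \o f) ->
  P.-integrable setT (EFin \o g) ->
  P.-integrable setT (EFin \o (fun w => f w + g w)).
Proof. by move=> fi gi; exact: (integrableD measurableT fi gi). Qed.

Let iZ (r : R) (f : T -> R) : P.-integrable setT (EFin \o f) ->
  P.-integrable setT (EFin \o (fun w => r * f w)).
Proof. by move=> fi; exact: (integrableZl measurableT r fi). Qed.

Let int_cst (r : R) : \int[P]_w r = r.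
Proof. by rewrite Rintegral_cst // [X in fine X]probability_setT mulr1. Qed.

Let int_N0 k : \int[P]_w N 0 w ^+ k.+1 = 0.
Proof.
rewrite -[RHS]int_cst; apply: eq_Rintegral => w _.
by rewrite /N big_ord0 add0r subrr expr0n.
Qed.

Lemma gain_martingale_sqr n : \int[P]_w N n w ^+ 2 <= n%:R.
Proof.
elim: n => [|n IH]; first by rewrite int_N0.
apply: (@le_trans _ _ (\int[P]_w (N n w ^+ 2 + (2 * (N n w ^+ 1 * incr n w) + 1)))).
  apply: le_Rintegral => //; first by apply: iD => //; apply: iD => //; exact: iZ.
  move=> w _; rewrite NS sqrrD expr1 -mulr_natl -addrA lerD2l lerD2l.
  by rewrite -real_normK ?num_real // expr_le1.
rewrite RintegralD //; last by apply: iD => //; exact: iZ.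
rewrite RintegralD // ?RintegralZl //; last exact: iZ.
rewrite gain_martingale_orthogonal mulr0 add0r.
by rewrite int_cst -natr1 lerD2r.
Qed.

(** In the binomial expansion, [4 a m^3 <= 2 a^2 m^2 + 2 m^4] follows from the square of [a - m];
    the terms of even degree in [m] then total at most [8 a^2 + 3]. *)
Let pow4_le (a m : R) : `|m| <= 1 ->
  (a + m) ^+ 4 <= a ^+ 4 + (4 * (a ^+ 3 * m) + (8 * a ^+ 2 + 3)).
Proof.
move=> m1.
have u1 : m ^+ 2 <= 1 by rewrite -real_normK ?num_real // expr_le1.
have u0 : 0 <= m ^+ 2 by exact: sqr_ge0.
have : 0 <= m ^+ 2 * (a - m) ^+ 2 by rewrite mulr_ge0 // sqr_ge0.
have : 0 <= a ^+ 2 * (1 - m ^+ 2) by rewrite mulr_ge0 ?sqr_ge0 // subr_ge0.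
have : 0 <= (1 + m ^+ 2) * (1 - m ^+ 2) by rewrite mulr_ge0 ?subr_ge0 ?addr_ge0.
nra.
Qed.

(** The cubic cross term has mean zero and the second moment is at most [n], so the step costs at
    most [8 n + 3], less than [4 (n + 1)^2 - 4 n^2]. *)
Lemma gain_martingale_pow4 n : \int[P]_w N n w ^+ 4 <= 4 * n%:R ^+ 2.
Proof.
elim: n => [|n IH]; first by rewrite int_N0 expr0n mulr0.
apply: (@le_trans _ _ (\int[P]_w (N n w ^+ 4 + (4 * (N n w ^+ 3 * incr n w) +
                                   (8 * N n w ^+ 2 + 3))))).
  apply: le_Rintegral => //.
    by do 2 (apply: iD => //); [exact: iZ|apply: iD => //; exact: iZ].
  by move=> w _; rewrite NS; exact: pow4_le.
have i8 : P.-integrable setT (EFin \o (fun w => 8 * N n w ^+ 2)) by exact: iZ.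
have i83 : P.-integrable setT (EFin \o (fun w => 8 * N n w ^+ 2 + 3)) by exact: iD.
have i4 : P.-integrable setT (EFin \o (fun w => 4 * (N n w ^+ 3 * incr n w))) by exact: iZ.
rewrite RintegralD //; last exact: iD.
rewrite RintegralD // RintegralZl // gain_martingale_orthogonal mulr0 add0r.
rewrite RintegralD // RintegralZl // int_cst.
by have := gain_martingale_sqr n; move: IH; rewrite -natr1; nra.
Qed.

End gain_martingale.

(** * Almost sure convergence from fourth moments *)

(** The sum of the series has finite expectation, hence is almost surely finite, and then its terms
    tend to 0. *)
Lemma ae_cvg0_of_summable (R : realType) d (T : measurableType d)
    (P : probability T R) (f : nat -> T -> R) :
  (forall n, measurable_fun setT (f n)) -> (forall n w, 0 <= f n w) ->
  (\sum_(n <oo) \int[P]_w (f n w)%:E < +oo)%E ->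
  {ae P, forall w, f n w @[n --> \oo] --> 0}.
Proof.
move=> mf f0 sumf; pose g w := (\sum_(n <oo) (f n w)%:E)%E.
have mEf n : measurable_fun setT (EFin \o f n) by exact/measurable_EFinP.
have g0 w : (0 <= g w)%E by apply: nneseries_ge0 => n _ _; rewrite lee_fin.
have ig : P.-integrable setT g.
  apply/integrableP; split.
    apply: (@ge0_emeasurable_sum _ _ _ setT (fun n w => (f n w)%:E) xpredT).
      by move=> n w _ _; rewrite lee_fin.
    by move=> n _; exact: mEf.
  under eq_integral do rewrite gee0_abs //.
  by rewrite integral_nneseries // => n w _; rewrite lee_fin.
have := integrable_ae measurableT ig.
apply: filterS => w /(_ I) gw; apply: cvg_series_cvg_0.
apply: nondecreasing_is_cvgn.
  by apply: nondecreasing_series => n _ _.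
exists (fine (g w)) => _ [n _ <-].
rewrite -lee_fin fineK // /series /= -sumEFin.
by apply: nneseries_lim_ge => k _ _; rewrite lee_fin.
Qed.

Lemma sum_inv_sqr_le (R : realType) n :
  \sum_(0 <= k < n.+1) (k.+1%:R ^+ 2)^-1 <= 2 - n.+1%:R^-1 :> R.
Proof.
elim: n => [|n IH]; first by rewrite big_nat1 expr1n invr1; lra.
rewrite big_nat_recr //= (le_trans (lerD IH (lexx _))) //.
set a : R := n.+1%:R; have a1 : 1 <= a by rewrite ler1n.
have -> : n.+2%:R = a + 1 :> R by rewrite -natr1.
have a0 : 0 < a by lra.
have -> : 2 - a^-1 + ((a + 1) ^+ 2)^-1 = 2 - (a + 1)^-1 - (a * (a + 1) ^+ 2)^-1.
  by field; apply/andP; split; apply: lt0r_neq0; lra.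
rewrite gerBl invr_ge0 mulr_ge0 // ?sqr_ge0 // ltW //.
Qed.

Lemma ae_cvg0_of_pow4 (R : realType) d (T : measurableType d)
    (P : probability T R) (N : nat -> T -> R) :
  (forall n, measurable_fun setT (N n)) -> (forall n w, `|N n w| <= n%:R) ->
  (forall n, \int[P]_w N n w ^+ 4 <= 4 * n%:R ^+ 2) ->
  {ae P, forall w, n%:R^-1 * N n w @[n --> \oo] --> 0}.
Proof.
(* The index is shifted by one so that the divisor is never 0. *)
move=> mN Nn N4; pose f n w := (n.+1%:R^-1 * N n.+1 w) ^+ 4.
have mf n : measurable_fun setT (f n).
  by apply: measurable_funX; exact: measurable_funM.
have f0 n w : 0 <= f n w by rewrite /f -[4%N]/(2 * 2)%N exprM sqr_ge0.
have fle n : (\int[P]_w (f n w)%:E <= (4 * (n.+1%:R ^+ 2)^-1)%:E)%E.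
  have iN : P.-integrable setT (EFin \o (fun w => N n.+1 w ^+ 4)).
    apply: (@bounded_integrable _ _ _ P _ (n.+1%:R ^+ 4)) => [|w].
      exact: measurable_funX.
    by rewrite normrX lerXn2r ?nnegrE.
  have a0 : 0 < n.+1%:R :> R by rewrite ltr0n.
  under eq_integral do rewrite /f exprMn EFinM.
  rewrite integralZl // -[X in (_ * X)%E]fineK ?integrable_fin_num // -EFinM lee_fin.
  apply: (le_trans (ler_wpM2l _ (N4 n.+1))).
    by rewrite exprn_ge0 // invr_ge0 ltW.
  rewrite le_eqVlt; apply/orP; left; apply/eqP; field; exact: lt0r_neq0.
have sumf : (\sum_(n <oo) \int[P]_w (f n w)%:E < +oo)%E.
  (* The bound 8 is 4 times the bound 2 on the sum of inverse squares. *)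
  apply: (@le_lt_trans _ _ 8%:E); last exact: ltry.
  apply: lime_le.
    apply: is_cvg_nneseries => n _ _.
    by apply: integral_ge0 => w _; rewrite lee_fin.
  apply: nearW => n.
  apply: (@le_trans _ _ (\sum_(0 <= k < n) (4 * (k.+1%:R ^+ 2)^-1)%:E)%E).
    by apply: lee_sum => k _; exact: fle.
  rewrite sumEFin lee_fin -mulr_sumr; case: n => [|n]; first by rewrite big_geq // mulr0.
  have := sum_inv_sqr_le R n; have : 0 <= n.+1%:R^-1 :> R by rewrite invr_ge0.
  by set r : R := n.+1%:R^-1; set S : R := \sum_(_ <= _ < _) _ => r0 Sr; lra.
have := ae_cvg0_of_summable mf f0 sumf; apply: filterS => w fw.
rewrite -(cvg_shiftS (fun n => n%:R^-1 * N n w)).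
apply/cvgr0Pnorm_lt => e e0.
have e4 : 0 < e ^+ 4 by rewrite exprn_gt0.
have /cvgr0Pnorm_lt/(_ _ e4) := fw.
apply: filterS => n; rewrite /f normrX.
by rewrite ltr_pXn2r // nnegrE // ltW.
Qed.

(* Variables with a law carried by the positive reals may still be negative on a
   null set, where [gain] leaves [0, 1]; clipping removes that set. *)
Section clipping.
Context {R : realType} d (T : measurableType d) (P : probability T R).

Let mclip (X : {RV P >-> R}) : measurable_fun setT (fun w => Num.max 0 (X w)).
Proof. exact: measurable_maxr. Qed.

Definition clip0 (X : {RV P >-> R}) : {RV P >-> R} :=
  MeasurableFun.Pack (MeasurableFun.Class (isMeasurableFun.Build _ _ _ _ _ (mclip X))).

Lemma clip0_ge0 (X : {RV P >-> R}) w : 0 <= clip0 X w.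
Proof. by rewrite /= le_max lexx. Qed.

Lemma clip0_cdf (X : {RV P >-> R}) (G : R -> R) :
  (forall s, s <= 0 -> G s = 0) -> is_distribution_function X G ->
  is_distribution_function (clip0 X) G.
Proof.
move=> G0 XG s; have [s0|s0] := leP 0 s.
  rewrite -XG; congr (P _); apply/seteqP.
  by split=> w /=; rewrite !in_itv /= ge_max s0.
have E : clip0 X @^-1` `]-oo, s] = set0.
  rewrite -subset0 => w /=; rewrite in_itv /= ge_max.
  by rewrite leNgt s0.
by rewrite G0 ?ltW // -[RHS](measure0 P) -E.
Qed.

Lemma clip0_indep (I : eqType) (X : I -> {RV P >-> R}) :
  mutually_independent X -> mutually_independent (fun i => clip0 (X i)).
Proof.
move=> Xi s B us mB; pose B' i := (fun y : R => Num.max 0 y) @^-1` B i.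
have mB' i : measurable (B' i).
  rewrite /B' -[_ @^-1` _]setTI; have : measurable_fun setT (fun y : R => Num.max 0 y).
    exact: measurable_maxr.
  by apply.
exact: (Xi s B' us mB').
Qed.

(** The two differ only inside [X <= 0], which has probability [G 0 = 0]. *)
Lemma ae_clip0 (X : {RV P >-> R}) (G : R -> R) :
  G 0 = 0 -> is_distribution_function X G -> {ae P, forall w, clip0 X w = X w}.
Proof.
move=> G0 XG; exists (X @^-1` `]-oo, 0]); split.
- exact: measurable_funPTI.
- by have := XG 0; rewrite G0.
- move=> w /= /eqP; rewrite in_itv /=; apply: contraR; rewrite -ltNge => w0.
  by rewrite max_r // ltW.
Qed.

End clipping.

Lemma ae_forall_nat (R : realType) d (T : measurableType d)
    (P : probability T R) (Q : nat -> T -> Prop) :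
  (forall n, {ae P, forall w, Q n w}) -> {ae P, forall w, forall n, Q n w}.
Proof.
move=> aeQ; rewrite /almost_everywhere /=.
have := negligible_bigcup aeQ.
by apply: negligibleS => w /=; rewrite -existsNE => -[n nQ]; exists n.
Qed.

Lemma measurable_bigmaxr (R : realType) d (T : measurableType d) (I : Type)
    (s : seq I) (f0 : T -> R) (f : I -> T -> R) :
  measurable_fun setT f0 -> (forall i, measurable_fun setT (f i)) ->
  measurable_fun setT (fun w => \big[Num.max/f0 w]_(i <- s) f i w).
Proof.
move=> mf0 mf; elim: s => [|i s IH].
  by under eq_fun do rewrite big_nil.
by under eq_fun do rewrite big_cons; exact: measurable_maxr.
Qed.

Lemma measurable_penalized_card (R : realType) d (T : measurableType d)
    (x : nat -> T -> R) n (A : {set 'I_n}) :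
  (forall i, measurable_fun setT (x i)) ->
  measurable_fun setT (fun w => penalized_card (fun i => x i w) A).
Proof.
move=> mx; apply: measurable_funB => //.
under eq_fun do rewrite big_mkcond.
apply: measurable_sum => p; case: (val p.2 == (val p.1).+1) => //.
exact: measurable_funM.
Qed.

(** * Law of large numbers for the maximum *)

Section law_of_large_numbers.
Context {R : realType} (G : R -> R).
Hypothesis GP : atomless_cdf G.
Context d (T : measurableType d) (P : probability T R) (xs : nat -> {RV P >-> R}).
Hypothesis xs_indep : mutually_independent xs.
Hypothesis xsG : forall n, is_distribution_function (xs n) G.

Let x n := clip0 (xs n).
Let S n w := \sum_(k < n) gain (fun i => x i w) k.
Local Notation c := (potential G 1).

Let G0 s : s <= 0 -> G s = 0. Proof. by case: GP => _ _ + _ _; apply. Qed.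
Let x_ge0 n w : 0 <= x n w. Proof. exact: clip0_ge0. Qed.
Let xG n : is_distribution_function (x n) G. Proof. exact: clip0_cdf. Qed.
Let x_indep : mutually_independent x. Proof. exact: clip0_indep. Qed.

(** The last bracket is at most 1 in absolute value, so it disappears after division by [n]. *)
Let S_N n w : S n w =
  gain_martingale G x n w + n%:R * c + (c - potential G (gain (fun i => x i w) n)).
Proof.
rewrite /gain_martingale sumrB sumr_const card_ord mulr_natl /S; ring.
Qed.

Let S_itv n w : 0 <= n%:R^-1 * S n w <= 1.
Proof.
have gi k := gain_itv k (fun i => x_ge0 i w).
rewrite mulr_ge0 ?invr_ge0 //=; last by apply: sumr_ge0 => k _; case/andP: (gi k).
(* At [n = 0] the convention that the inverse of 0 is 0 gives the quotient 0. *)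
case: n => [|n]; first by rewrite invr0 mul0r.
rewrite mulrC ler_pdivrMr // mul1r.
apply: (@le_trans _ _ (\sum_(k < n.+1) 1)); last by rewrite sumr_const card_ord.
by apply: ler_sum => k _; case/andP: (gi k).
Qed.

Let ae_S : {ae P, forall w, n%:R^-1 * S n w @[n --> \oo] --> c}.
Proof.
have := ae_cvg0_of_pow4 (gain_martingale_measurable GP x)
  (gain_martingale_bound GP x_ge0 xG)
  (gain_martingale_pow4 GP x_indep x_ge0 xG).
apply: filterS => w Nw.
have r0 : n%:R^-1 * (c - potential G (gain (fun i => x i w) n)) @[n --> \oo] --> 0.
  apply/cvgr0Pnorm_le => e e0.
  near=> n; have n0 : 0 < n%:R :> R by rewrite ltr0n; near: n; exact: nbhs_infty_gt.
  have /andP[p0 p1] := potential_itv GP (gain_itv n (fun i => x_ge0 i w)).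
  have /andP[c0 c1] : 0 <= c <= 1 by apply: (potential_itv GP); rewrite ler01 lexx.
  rewrite normrM gtr0_norm ?invr_gt0 // mulrC ler_pdivrMr //.
  apply: (@le_trans _ _ 1); first by rewrite ler_norml; apply/andP; split; lra.
  rewrite mulrC -ler_pdivrMr // div1r; near: n; exact: nbhs_infty_ger.
rewrite -[X in _ --> X]addr0 -[X in _ --> X]addr0.
apply: cvg_trans (cvgD (cvgD (cvg_cst c) Nw) r0).
apply: near_eq_cvg; near=> n.
have n0 : n%:R != 0 :> R by rewrite pnatr_eq0 -lt0n; near: n; exact: nbhs_infty_gt.
by rewrite S_N !fctE !mulrDr mulKf //; ring.
Unshelve. all: by end_near. Qed.

Let M n w := max_penalized_card (fun i => xs i w) n.

Let mM n : measurable_fun setT (M n).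
Proof.
by apply: measurable_bigmaxr => [|A]; exact: measurable_penalized_card.
Qed.

Let mS n : measurable_fun setT (S n).
Proof.
rewrite (_ : S n = fun w => max_penalized_card (fun i => x i w) n).
  by apply: measurable_bigmaxr => [|A]; exact: measurable_penalized_card.
by apply/funext => w; rewrite max_penalized_card_sum_gain.
Qed.

(** A countable union of null sets is null, so clipped and original variables agree for all indices
    at once. *)
Let ae_MS : {ae P, forall w, forall n, M n w = S n w}.
Proof.
have := ae_forall_nat (fun n => ae_clip0 (G0 (lexx 0)) (xsG n)).
apply: filterS => w xw n; rewrite /S -max_penalized_card_sum_gain //.
by rewrite /M; congr max_penalized_card; apply/funext => i; rewrite -xw.
Qed.

Lemma ae_cvg_max_penalized_card :
  {ae P, forall w, n%:R^-1 * M n w @[n --> \oo] --> c}.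
Proof.
by move: ae_MS ae_S; apply: filterS2 => w MS; under eq_fun do rewrite -MS.
Qed.

(** [M] is replaced by [S], equal to it almost surely; since [S n / n] lies in [[0, 1]] at every
    point, dominated convergence applies with the constant 1. *)
Lemma cvg_L1_max_penalized_card : cvg_L1 P (fun n w => n%:R^-1 * M n w) c.
Proof.
have iS n : P.-integrable setT (EFin \o (fun w => n%:R^-1 * S n w)).
  apply: (@bounded_integrable _ _ _ P _ 1) => [|w]; first exact: measurable_funM.
  by case/andP: (S_itv n w) => ? ?; rewrite ger0_norm.
split=> [n|].
  apply/Lfun1_integrable/integrableP; split.
    by apply/measurable_EFinP; exact: measurable_funM.
  rewrite (@ae_eq_integral _ _ _ P setT
    (fun w => `|(n%:R^-1 * S n w)%R%:E|%E)) //; last 3 first.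
  - by apply: measurableT_comp => //; apply/measurable_EFinP; exact: measurable_funM.
  - by apply: measurableT_comp => //; apply/measurable_EFinP; exact: measurable_funM.
  - by move: ae_MS; apply: filterS => w MS _ /=; rewrite MS.
  by have /integrableP[] := iS n.
have E n : ('E_P[fun w => `|n%:R^-1 * M n w - c|%R] =
    \int[P]_w `|(n%:R^-1 * S n w)%R%:E - c%:E|)%E.
  rewrite unlock; apply: ae_eq_integral => //.
  - apply/measurable_EFinP; apply: measurableT_comp => //.
    by apply: measurable_funB => //; exact: measurable_funM.
  - apply: measurableT_comp => //; apply/measurable_EFinP.
    by apply: measurable_funB => //; exact: measurable_funM.
  - by move: ae_MS; apply: filterS => w MS _ /=; rewrite MS.
under eq_fun do rewrite E.
have [] := @dominated_convergence _ _ _ P setT measurableT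
  (fun n w => (n%:R^-1 * S n w)%:E) (cst c%:E) (cst 1%:E).
- by move=> n; apply/measurable_EFinP; exact: measurable_funM.
- exact: measurable_cst.
- move: ae_S; apply: filterS => w Sw _; apply: cvg_EFin => //.
  exact: nearW.
- exact: (@bounded_integrable _ _ _ P (fun=> 1) `|1|).
- by apply: aeW => w n _; case/andP: (S_itv n w) => ? ?; rewrite /= lee_fin ger0_norm.
by [].
Qed.

End law_of_large_numbers.

(** * The formula for the constant *)

(** The rays unbounded to the right generate the Borel sets and are stable under intersection; their
    masses are the complements of the distribution function. *)
Lemma same_cdf_same_law (R : realType) d (T : measurableType d)
    (P : probability T R) (X : {RV P >-> R}) d' (T' : measurableType d')
    (P' : probability T' R) (X' : {RV P' >-> R}) :
  (forall s, cdf X s = cdf X' s) -> same_law X X'.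
Proof.
move=> XX' B mB.
have := @measure_unique _ R _ (@RGenOInfty.G R) (fun n => `](- n%:R), +oo[%classic)
  _ _ _ _ (distribution P X) (distribution P' X') _ _ B mB.
apply => //.
- exact: RGenOInfty.measurableE.
- move=> _ _ [a ->] [b ->]; exists (Num.max a b); apply/seteqP.
  by split => r /=; rewrite !in_itv /= !andbT gt_max => /andP.
- by move=> n; exists (- n%:R).
- rewrite -subTset => r _; exists (Num.truncn `|r|).+1 => //=.
  rewrite in_itv /= andbT ltrNl (le_lt_trans (ler_norm _)) // normrN.
  exact: truncnS_gt.
- by move=> _ [a ->]; have := ccdf_1_cdf X a; rewrite XX' -ccdf_1_cdf.
- move=> n; rewrite (@le_lt_trans _ _ 1%E) ?ltry //; exact: probability_le1.
Qed.

Lemma eq_law_integral (R : realType) d (T : measurableType d)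
    (P : probability T R) (X Y : {RV P >-> R}) (f : R -> R) :
  same_law X Y -> measurable_fun setT f -> (forall r, 0 <= f r) ->
  (\int[P]_w (f (X w))%:E = \int[P]_w (f (Y w))%:E)%E.
Proof.
move=> XY mf f0.
have mEf : measurable_fun setT (EFin \o f) by exact/measurable_EFinP.
have Ef0 r : (0 <= (EFin \o f) r)%E by rewrite lee_fin.
have := @ge0_integral_distribution _ _ _ _ _ P X _ mEf Ef0 => /= <-.
have := @ge0_integral_distribution _ _ _ _ _ P Y _ mEf Ef0 => /= <-.
by apply: eq_measure_integral => B mB _; exact: XY.
Qed.

Section exchange.
Context {R : realType} d (T : measurableType d) (P : probability T R).
Variables A U : {RV P >-> R}.
Hypotheses (AU_indep : indep2 P A U) (AU_law : same_law U A).

(** Both sides become iterated integrals over two copies of the sample space; equality of laws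
    replaces [U] by [A] in each, and Tonelli swaps the order. *)
Lemma exchange_integral (f : R * R -> R) (K : R) :
  measurable_fun setT f -> (forall z, 0 <= f z) ->
  (forall w v, f (A w, U v) <= K) -> (forall w v, f (U w, A v) <= K) ->
  \int[P]_w f (A w, U w) = \int[P]_w f (U w, A w).
Proof.
move=> mf f0 fK fK'; rewrite /Rintegral; congr fine.
have mfs : measurable_fun setT (f \o (fun z => (z.2, z.1))).
  apply: measurableT_comp => //.
  exact: measurable_fun_pair measurable_snd measurable_fst.
rewrite (@integral_indep2 _ _ _ _ _ _ _ P A U f K) //; last first.
  by move=> w v; rewrite ger0_norm.
have := @integral_indep2 _ _ _ _ _ _ _ P A U _ K AU_indep mfs.
move=> /= ->; last by move=> w v; rewrite ger0_norm.
under eq_integral => w _.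
  rewrite (eq_law_integral (f := fun u => f (A w, u)) AU_law) //; last first.
    exact: measurableT_comp mf (measurable_pair1 _).
  over.
under [RHS]eq_integral => w _.
  rewrite (eq_law_integral (f := fun u => f (u, A w)) AU_law) //; last first.
    exact: measurableT_comp mf (measurable_pair2 _).
  over.
apply: (@fubini_tonelli _ _ _ _ R P P (fun z => (f (A z.1, A z.2))%:E)).
  apply/measurable_EFinP; apply: (measurableT_comp mf).
  apply: measurable_fun_pair.
    exact: measurableT_comp measurable_fst.
  exact: measurableT_comp measurable_snd.
by move=> z; rewrite lee_fin.
Qed.

End exchange.

Lemma probability_eq0 (R : realType) d (T : measurableType d)
    (P : probability T R) (X : {RV P >-> R}) (H : R -> R) (t : R) :
  is_distribution_function X H -> {for t, continuous H} ->
  P [set w | X w = t] = 0%E.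
Proof.
move=> XH Ht.
have mlt : measurable [set w | X w < t].
  exact: (measurable_ltr_set (measurable_funPT X) (measurable_cst t)).
have mle : measurable [set w | X w <= t].
  exact: (measurable_ler_set (measurable_funPT X) (measurable_cst t)).
have cdfE : P [set w | X w <= t] = (H t)%:E by rewrite -XH.
rewrite (_ : [set w | X w = t] = [set w | X w <= t] `\` [set w | X w < t]).
  rewrite measureD //.
    rewrite setIidr; last by move=> w /= /ltW.
    by rewrite [X in (X - _)%E]cdfE [X in (_ - X)%E](probability_lt XH Ht) subee.
  by rewrite [X in (X < _)%E]cdfE ltry.
apply/seteqP; split => w /=; first by move=> ->; rewrite lexx ltxx.
by move=> [wt /negP]; rewrite -leNgt => tw; apply/le_anti/andP.
Qed.

Section messages.
Context {R : realType} (G : R -> R).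
Hypothesis GP : atomless_cdf G.
Local Notation phi := (message_tail G).
Let F (s : R) := 1 - phi (1 - s).
Context d (T : measurableType d) (P : probability T R).

Let F_cont : continuous F.
Proof. exact: stationary_cdf_continuous. Qed.

Let G_cont : continuous G. Proof. by case: GP. Qed.

Lemma message_cdf (A : {RV P >-> R}) :
  (forall w, 0 <= A w <= 1) ->
  (forall s : R, 0 <= s <= 1 -> cdf A s = (cdf_F G s)%:E) ->
  is_distribution_function A F.
Proof.
move=> A01 AF s; have [s0|s0] := ltP s 0.
  rewrite /F message_tail_ge1 // ?subrr; last by lra.
  have E : A @^-1` `]-oo, s] = set0.
    rewrite -subset0 => w /=; rewrite in_itv /=.
    by case/andP: (A01 w) => w0 _; rewrite leNgt (lt_le_trans s0).
  by rewrite -[RHS](measure0 P) -E.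
have [s1|s1] := leP s 1.
  by rewrite AF ?s0 // cdf_F_message_tail.
rewrite /F message_tail_le0 // ?subr0; last by lra.
have E : A @^-1` `]-oo, s] = setT.
  rewrite -subTset => w _ /=; rewrite in_itv /=.
  by case/andP: (A01 w) => _ w1; rewrite (le_trans w1) // ltW.
by rewrite -[RHS](probability_setT P) -E.
Qed.

(** The mean of a nonnegative variable is the integral of its tail, here [phi (1 - s)], which
    vanishes for [s] above 1. *)
Lemma message_mean (A : {RV P >-> R}) :
  (forall w, 0 <= A w <= 1) -> is_distribution_function A F ->
  \int[P]_w A w = potential G 1.
Proof.
move=> A01 AF; rewrite /Rintegral.
have := @ge0_expectation_ccdf _ _ _ P A (fun w => proj1 (andP (A01 w))).
rewrite unlock => ->.
rewrite (potential1_onem GP) /Rintegral; congr fine; rewrite [LHS]integral_mkcond [RHS]integral_mkcond.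
apply: eq_integral => s _; rewrite !patchE !mem_setE !in_itv /= andbT.
case: (leP 0 s) => //= s0; rewrite ccdf_1_cdf AF -EFinB /F subKr.
by case: (leP s 1) => // s1; rewrite message_tail_le0 //; lra.
Qed.

Section one_sided.
Variables A V B : {RV P >-> R}.
Hypotheses (A01 : forall w, 0 <= A w <= 1) (B01 : forall w, 0 <= B w <= 1).
Hypotheses (AF : is_distribution_function A F) (BF : is_distribution_function B F).
Hypotheses (V_ge0 : forall w, 0 <= V w) (VG : is_distribution_function V G).
Hypothesis AVB : forall a v b, measurable a -> measurable v -> measurable b ->
  (P (V @^-1` v `&` B @^-1` b `&` A @^-1` a) =
   P (V @^-1` v) * P (B @^-1` b) * P (A @^-1` a))%E.

Let mU : measurable_fun setT (fun w => 1 - Num.min (V w) (B w)).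
Proof. by apply: measurable_funB => //; exact: measurable_minr. Qed.

Let U : {RV P >-> R} :=
  MeasurableFun.Pack (MeasurableFun.Class (isMeasurableFun.Build _ _ _ _ _ mU)).

Let VB : indep2 P V B.
Proof.
move=> v b mv mb; have := AVB measurableT mv mb.
by rewrite preimage_setT setIT probability_setT mule1.
Qed.

Let AU_indep : indep2 P A U.
Proof.
move=> a u ma mu.
have mmin : measurable_fun setT (fun z : R * R => 1 - Num.min z.1 z.2).
  by apply: measurable_funB => //; exact: measurable_minr.
have mC : measurable ((fun z : R * R => 1 - Num.min z.1 z.2) @^-1` u).
  by rewrite -[_ @^-1` _]setTI; exact: mmin.
have mAa : measurable (A @^-1` a) by exact: measurable_funPTI.
rewrite setIC muleC.
apply: (indep_pair_event mAa _ mC) => v b mv mb.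
by rewrite AVB // VB.
Qed.

(** [U <= s] means that [V] and [B] are both at least [1 - s], with probability
    [(1 - G (1 - s)) * phi s]; the fixed-point equation at [1 - s] identifies it with [F s]. *)
Let UF : is_distribution_function U F.
Proof.
move=> s; have mge X t : measurable [set w | t <= (X : {RV P >-> R}) w].
  exact: (measurable_ler_set (measurable_cst t) (measurable_funPT X)).
have -> : cdf U s = P ([set w | 1 - s <= V w] `&` [set w | 1 - s <= B w]).
  congr (P _); apply/seteqP; split => w /=.
    by rewrite in_itv /= lerBlDl -lerBlDr le_min => /andP.
  by move=> [Vw Bw]; rewrite in_itv /= lerBlDl -lerBlDr le_min Vw.
have preim X t : [set w | t <= (X : {RV P >-> R}) w] = X @^-1` `[t, +oo[%classic.
  by apply/seteqP; split => w /=; rewrite in_itv /= andbT.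
rewrite !preim VB // -!preim [X in (X * _)%E](probability_ge VG (@G_cont (1 - s))).
rewrite [X in (_ * X)%E](probability_ge BF (@F_cont (1 - s))).
rewrite -EFinM /F !subKr; congr (_%:E).
by have := message_tail_fixpoint GP (1 - s); rewrite subKr; lra.
Qed.

Let UA_law : same_law U A.
Proof. by apply: same_cdf_same_law => s; rewrite UF AF. Qed.

(* [U := 1 - min(V, B)] is a copy of [A] independent of [A]; this is
   E[A; A + U > 1] = E[U; A + U > 1]. *)
Lemma exchange_identity :
  \int[P]_w ((A w - 1 + Num.min (V w) (B w)) * (Num.min (V w) (B w) < A w)%R%:R) = 0.
Proof.
have U01 w : 0 <= U w <= 1.
  have /andP[B0 B1] := B01 w.
  by rewrite /= subr_ge0 ge_min B1 orbT /= lerBlDr lerDl le_min V_ge0.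
(* The positive part makes [f] nonnegative everywhere and changes nothing on [A] and [U], which lie
   in [[0, 1]]. *)
pose f (z : R * R) := Num.max 0 z.1 * \1_[set z : R * R | 1 < z.1 + z.2] z.
have m1 : measurable [set z : R * R | 1 < z.1 + z.2].
  apply: measurable_ltr_set => //; exact: measurable_funD.
have mf : measurable_fun setT f.
  apply: measurable_funM; last exact: measurable_indic.
  exact: measurable_maxr.
have f0 z : 0 <= f z by rewrite mulr_ge0 // le_max lexx.
have f1 (X Y : {RV P >-> R}) : (forall w, 0 <= X w <= 1) ->
    forall w v, f (X w, Y v) <= 1.
  move=> X01 w v; case/andP: (X01 w) => X0 X1.
  by rewrite -[leRHS]mulr1 ler_pM // ?le_max ?lexx // ge_max ler01.
have iXY (X Y : {RV P >-> R}) : (forall w, 0 <= X w <= 1) ->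
    P.-integrable setT (EFin \o (fun w => f (X w, Y w))).
  move=> X01; apply: (@bounded_integrable _ _ _ P _ 1) => [|w].
    exact: measurableT_comp mf (measurable_fun_pair (measurable_funPT X) (measurable_funPT Y)).
  by rewrite ger0_norm // f1.
have := exchange_integral AU_indep UA_law mf f0 (f1 _ _ A01) (f1 _ _ U01).
move/eqP; rewrite -subr_eq0 -RintegralB //; [move/eqP|exact: iXY|exact: iXY].
move=> E; rewrite -[RHS]E; apply: eq_Rintegral => w _.
rewrite /f !indicE !mem_set_bool /= (max_r (proj1 (andP (A01 w)))).
rewrite (max_r (proj1 (andP (U01 w)))) /=.
set m := Num.min _ _.
have -> : (1 < A w + (1 - m)) = (m < A w) by rewrite addrCA ltrDl subr_gt0.
have -> : (1 < 1 - m + A w) = (m < A w) by rewrite -addrA ltrDl addrC subr_gt0.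
by case: (m < A w); rewrite ?mulr1 ?mulr0 ?subr0 //; ring.
Qed.

End one_sided.

End messages.

Lemma mutually_independent3 (R : realType) d (T : measurableType d)
    (P : probability T R) (X Y Z : {RV P >-> R}) (a b c : set R) :
  mutually_independent (tnth [tuple X; Y; Z]) ->
  measurable a -> measurable b -> measurable c ->
  (P (X @^-1` a `&` (Y @^-1` b `&` Z @^-1` c)) =
   P (X @^-1` a) * (P (Y @^-1` b) * P (Z @^-1` c)))%E.
Proof.
move=> ind ma mb mc.
pose s : seq 'I_3 := [:: @Ordinal 3 0 isT; @Ordinal 3 1 isT; @Ordinal 3 2 isT].
have := ind s (tnth [tuple a; b; c]) isT.
rewrite bigcap_seq !big_cons !big_nil setIT mule1; apply.
by move=> i; rewrite (tnth_nth set0); case: i => -[|[|[|]]].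
Qed.

(** If [v < min(a, b)], both indicators are 1 and both minima equal [v]. Otherwise only the summand
    led by the larger of [a], [b] survives, with value [a + b - 1]; at a tie neither would. *)
Lemma exchange_pointwise (R : realType) (a b v : R) : a != b ->
  (a - 1 + Num.min v b) * (Num.min v b < a)%R%:R +
  (b - 1 + Num.min v a) * (Num.min v a < b)%R%:R =
  a + (b + (- 1 + (2 * (v * (v < Num.min a b)%R%:R) +
                   (- 1) * (v < Num.min a b)%R%:R))).
Proof.
case: (ltgtP a b) => // ab _;
case: (leP v b) => vb; case: (leP v a) => va; case: ltP => ? /=;
  case: ltP => ? /=; try case: ltP => ? /=; lra.
Qed.

Section triple.
Context {R : realType} (G : R -> R).
Hypothesis GP : atomless_cdf G.
Context d (T : measurableType d) (P : probability T R).
Local Notation phi := (message_tail G).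
Local Notation c := (potential G 1).

(** Integrating the pointwise identity gives [0 = 2 c - 1 + 2 E[V J] - E[J]], where [J] indicates
    [V < min(A, B)]; this is then solved for [c]. *)
Lemma boundary_triple_constant (A X B : {RV P >-> R}) :
  boundary_triple G A X B -> constant_formula c A X B.
Proof.
move=> [ind XG AB01 ABF].
have A01 w : 0 <= A w <= 1 by case: (AB01 w).
have B01 w : 0 <= B w <= 1 by case: (AB01 w).
have AF := message_cdf GP A01 (fun s s01 => proj1 (ABF s s01)).
have BF := message_cdf GP B01 (fun s s01 => proj2 (ABF s s01)).
have G0 s : s <= 0 -> G s = 0 by case: GP => _ _ + _ _; apply.
pose V := clip0 X.
have V_ge0 w : 0 <= V w by exact: clip0_ge0.
have VG : is_distribution_function V G by exact: clip0_cdf.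
have aeV : {ae P, forall w, V w = X w} by apply: (ae_clip0 _ XG); exact: G0.
have ind3 a v b : measurable a -> measurable v -> measurable b ->
    (P (A @^-1` a `&` (V @^-1` v `&` B @^-1` b)) =
     P (A @^-1` a) * (P (V @^-1` v) * P (B @^-1` b)))%E.
  move=> ma mv mb.
  have mv' : measurable ((fun y : R => Num.max 0 y) @^-1` v).
    have mmax : measurable_fun setT (fun y : R => Num.max 0 y).
      exact: measurable_maxr.
    by rewrite -[_ @^-1` _]setTI; exact: mmax.
  exact: (mutually_independent3 ind ma mv' mb).
have EA : \int[P]_w ((A w - 1 + Num.min (V w) (B w)) *
    (Num.min (V w) (B w) < A w)%R%:R) = 0.
  apply: (exchange_identity GP A01 B01 AF BF V_ge0 VG) => a v b ma mv mb.
  by rewrite setIC ind3 // muleC.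
have EB : \int[P]_w ((B w - 1 + Num.min (V w) (A w)) *
    (Num.min (V w) (A w) < B w)%R%:R) = 0.
  apply: (exchange_identity GP B01 A01 BF AF V_ge0 VG) => a v b ma mv mb.
  rewrite (setIC (V @^-1` v)) -setIA ind3 // muleCA muleA.
  by [].
pose J w : R := (V w < Num.min (A w) (B w))%R%:R.
have mJset : measurable [set w | V w < Num.min (A w) (B w)].
  by apply: measurable_ltr_set => //; exact: measurable_minr.
have JE : J = \1_[set w | V w < Num.min (A w) (B w)].
  by apply/funext => w; rewrite indicE mem_set_bool.
have mJ : measurable_fun setT J by rewrite JE; exact: measurable_indic.
have AB : indep2 P A B.
  move=> a b ma mb; have := ind3 _ _ _ ma measurableT mb.
  by rewrite preimage_setT setTI probability_setT mul1e.
(* By independence the tie event is integrated section by section, and each section [B = A w] is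
   null because [F] is continuous. *)
have no_ties : {ae P, forall w, A w != B w}.
  pose D : set (R * R) := [set z | z.1 == z.2].
  have mD : measurable D.
    rewrite (_ : D = [set z | z.1 <= z.2] `&` [set z | z.2 <= z.1]); last first.
      apply/seteqP; split => z /=; first by move=> /eqP ->; rewrite lexx.
      by move=> [? ?]; apply/eqP/le_anti/andP.
    by apply: measurableI; exact: measurable_ler_set.
  have mE : measurable [set w | A w == B w].
    rewrite (_ : [set w | _] = (fun w => (A w, B w)) @^-1` D) //.
    have mAB : measurable_fun setT (fun w => (A w, B w)) by exact: measurable_fun_pair.
    by rewrite -[_ @^-1` _]setTI; exact: mAB.
  exists [set w | A w == B w]; split => //; last first.
    by move=> w /= /negP; rewrite negbK.
  have mID : measurable_fun setT (\1_D : R * R -> R) by exact: measurable_indic.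
  rewrite -[X in P X]setIT -integral_indic //.
  have := @integral_indep2 _ _ _ _ _ _ _ P A B (\1_D) 1 AB mID.
  rewrite (eq_integral (fun w => (\1_[set v | A v == B v] w)%:E)); last first.
    by move=> w _; rewrite !indicE /D !mem_set_bool.
  move=> ->; last by move=> w v; rewrite indicE; case: (_ \in _); rewrite ?normr1 ?normr0.
  apply: integral0_eq => w _.
  rewrite (eq_integral (fun v => (\1_[set v | B v = A w] v)%:E)); last first.
    move=> v _; rewrite !indicE /D mem_set_bool /= eq_sym.
    by rewrite (_ : (v \in [set v | B v = A w]) = (B v == A w)) //;
      apply/idP/idP => [/set_mem/eqP|/eqP/mem_set].
  have mBw : measurable [set v | B v = A w].
    exact: (measurable_funPTI B (measurable_set1 (A w))).
  rewrite integral_indic // setIT; apply: (probability_eq0 BF).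
  exact: stationary_cdf_continuous.
have aeJ : {ae P, forall w, \1_(below_both A X B) w = J w}.
  move: aeV; apply: filterS => w Vw.
  by rewrite /J indicE /below_both mem_set_bool Vw.
have mX01 (X' : {RV P >-> R}) : (forall w, 0 <= X' w <= 1) ->
    P.-integrable setT (EFin \o X').
  move=> X01; apply: (@bounded_integrable _ _ _ P _ 1) => // w.
  by case/andP: (X01 w) => ? ?; rewrite ger0_norm.
have iJ : P.-integrable setT (EFin \o J).
  apply: (@bounded_integrable _ _ _ P _ 1) => // w.
  by rewrite /J; case: (_ < _); rewrite ?normr1 ?normr0.
(* [V] itself may be unbounded, but where [J] is 1 it is below [A], hence below 1. *)
have VJ w : 0 <= V w * J w <= 1.
  rewrite /J; case: ltP => Vm; rewrite ?mulr1 ?mulr0 ?lexx ?ler01 //.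
  rewrite V_ge0 (le_trans (ltW Vm)) // ge_min.
  by case/andP: (A01 w) => _ ->.
have mVJ : measurable_fun setT (fun w => V w * J w) by exact: measurable_funM.
have iVJ : P.-integrable setT (EFin \o (fun w => V w * J w)).
  apply: (@bounded_integrable _ _ _ P _ 1) => // w.
  by case/andP: (VJ w) => ? ?; rewrite ger0_norm.
have mbelow : measurable (below_both A X B).
  by apply: measurable_ltr_set => //; exact: measurable_minr.
have PE : P (below_both A X B) = (\int[P]_w J w)%:E.
  rewrite /Rintegral fineK ?integrable_fin_num // -[X in P X]setIT -integral_indic //.
  apply: ae_eq_integral => //; first exact/measurable_EFinP.
    exact/measurable_EFinP.
  by move: aeJ; apply: filterS => w Jw _; rewrite /= Jw.
have EE : ('E_P[fun w => (X w * \1_(below_both A X B) w)%R] =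
    (\int[P]_w (V w * J w))%R%:E)%E.
  rewrite unlock /Rintegral fineK ?integrable_fin_num //.
  apply: ae_eq_integral => //.
  - apply/measurable_EFinP; apply: measurable_funM => //; exact: measurable_indic.
  - exact/measurable_EFinP.
  - by move: aeJ aeV; apply: filterS2 => w Jw Vw _; rewrite Jw -Vw.
rewrite /constant_formula PE EE -EFinM -[X in (X - _)%E]EFinD -EFinB; congr (_%:E).
pose fA w := (A w - 1 + Num.min (V w) (B w)) * (Num.min (V w) (B w) < A w)%R%:R.
pose fB w := (B w - 1 + Num.min (V w) (A w)) * (Num.min (V w) (A w) < B w)%R%:R.
have side (C D : {RV P >-> R}) : (forall w, 0 <= C w <= 1) ->
    (forall w, 0 <= D w <= 1) ->
    P.-integrable setT (EFin \o (fun w =>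
      (C w - 1 + Num.min (V w) (D w)) * (Num.min (V w) (D w) < C w)%R%:R)).
  move=> C01 D01.
  have mmin : measurable_fun setT (fun w => Num.min (V w) (D w)) by exact: measurable_minr.
  have mlt : measurable [set w | Num.min (V w) (D w) < C w] by exact: measurable_ltr_set.
  apply: (@bounded_integrable _ _ _ P _ 1) => [|w].
    rewrite (_ : (fun w => _) = (fun w => (C w - 1 + Num.min (V w) (D w)) *
       \1_[set w | Num.min (V w) (D w) < C w] w)); last first.
      by apply/funext => w; rewrite indicE mem_set_bool.
    apply: measurable_funM; last exact: measurable_indic.
    by apply: measurable_funD => //; exact: measurable_funB.
  have /andP[C0 C1] := C01 w; have /andP[D0 D1] := D01 w.
  have m0 : 0 <= Num.min (V w) (D w) by rewrite le_min V_ge0.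
  have m1 : Num.min (V w) (D w) <= 1 by rewrite ge_min D1 orbT.
  rewrite normrM -[leRHS]mulr1 ler_pM //.
    by rewrite ler_norml; apply/andP; split; lra.
  by case: (_ < _); rewrite ?normr1 ?normr0.
have iA := side _ _ A01 B01; have iB := side _ _ B01 A01.
have icst (r : R) : P.-integrable setT (EFin \o (fun=> r)).
  exact: (@bounded_integrable _ _ _ P _ `|r|).
have iD (f g : T -> R) : P.-integrable setT (EFin \o f) ->
    P.-integrable setT (EFin \o g) ->
    P.-integrable setT (EFin \o (fun w => f w + g w)).
  by move=> fi gi; exact: (integrableD measurableT fi gi).
have iZ (r : R) (f : T -> R) : P.-integrable setT (EFin \o f) ->
    P.-integrable setT (EFin \o (fun w => r * f w)).
  by move=> fi; exact: (integrableZl measurableT r fi).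
have iS2 : P.-integrable setT (EFin \o (fun w => 2 * (V w * J w) + (- 1) * J w)).
  by apply: iD; exact: iZ.
have iS1 : P.-integrable setT
    (EFin \o (fun w => - 1 + (2 * (V w * J w) + (- 1) * J w))) by exact: iD.
have iSB : P.-integrable setT
    (EFin \o (fun w => B w + (- 1 + (2 * (V w * J w) + (- 1) * J w)))).
  by apply: iD => //; exact: mX01.
have : \int[P]_w (fA w + fB w) =
    \int[P]_w (A w + (B w + (- 1 + (2 * (V w * J w) + (- 1) * J w)))).
  rewrite /Rintegral; congr fine; apply: ae_eq_integral => //.
  - by apply: (measurable_int P); apply: iD.
  - by apply: (measurable_int P); apply: iD => //; exact: mX01.
  move: no_ties; apply: filterS => w ABw _; congr (_%:E).
  exact: exchange_pointwise.
rewrite [LHS]RintegralD // [X in X + _]EA [X in _ + X]EB addr0.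
rewrite RintegralD //; last exact: mX01.
rewrite RintegralD //; last exact: mX01.
rewrite RintegralD // (RintegralD measurableT (iZ _ _ iVJ) (iZ _ _ iJ)) !RintegralZl //.
rewrite !(message_mean GP) // Rintegral_cst // [X in fine X]probability_setT /=.
set iVJ' := \int[P]_x (V x * J x); set iJ' := \int[P]_x J x; lra.
Qed.

End triple.

(** * Existence of a boundary triple *)

(** Indices outside [s] receive the full set, which has probability 1, so every subfamily reduces to
    the whole triple. *)
Lemma mutually_independent_triple (R : realType) d (T : measurableType d)
    (P : probability T R) (X Y Z : {RV P >-> R}) :
  (forall a b c, measurable a -> measurable b -> measurable c ->
    (P (X @^-1` a `&` (Y @^-1` b `&` Z @^-1` c)) =
     P (X @^-1` a) * (P (Y @^-1` b) * P (Z @^-1` c)))%E) ->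
  mutually_independent (tnth [tuple X; Y; Z]).
Proof.
move=> ind s B us mB.
pose i0 := @Ordinal 3 0 isT; pose i1 := @Ordinal 3 1 isT; pose i2 := @Ordinal 3 2 isT.
have I3 (i : 'I_3) : [\/ i = i0, i = i1 | i = i2].
  by case: i => -[|[|[|]]] // h; [constructor 1|constructor 2|constructor 3]; exact: val_inj.
pose B' i := if i \in s then B i else setT.
have mB' i : measurable (B' i) by rewrite /B'; case: ifP.
pose W i := tnth [tuple X; Y; Z] i.
have -> : \bigcap_(i in [set` s]) (W i @^-1` B i) =
    X @^-1` B' i0 `&` (Y @^-1` B' i1 `&` Z @^-1` B' i2).
  apply/seteqP; split => [w Bw|w [B0 [B1 B2]] i /= si].
    by split; [|split]; rewrite /= /B'; case: ifP => // /Bw.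
  have : B' i (W i w) by case: (I3 i) => ->.
  by rewrite /B' si.
rewrite ind // big_uniq //= big_mkcond /= !big_ord_recl big_ord0 mule1.
have E i : (if i \in s then P (W i @^-1` B i) else 1)%E = P (W i @^-1` B' i).
  by rewrite /B'; case: ifP => // _; rewrite preimage_setT probability_setT.
by rewrite !E; congr (_ * (_ * _))%E; congr (P (_ @^-1` B' _)); exact: val_inj.
Qed.

Section existence.
Context {R : realType} (G : R -> R).
Hypothesis GP : atomless_cdf G.
Local Notation phi := (message_tail G).
Let F (s : R) := 1 - phi (1 - s).

Let F_nd : nondecreasing F.
Proof. by move=> s t st; rewrite lerD2l lerN2 message_tail_nd // lerD2l lerN2. Qed.

Let F_rc : right_continuous F.
Proof. exact/right_continuousW/stationary_cdf_continuous. Qed.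

Let FNy : F @ -oo --> (0 : R).
Proof.
apply: cvg_near_cst; near=> s.
rewrite /F message_tail_ge1 // ?subrr // lerBrDl gerDr.
by near: s; exact: nbhs_ninfty_le.
Unshelve. all: by end_near. Qed.

Let Fy : F @ +oo --> (1 : R).
Proof.
apply: cvg_near_cst; near=> s.
rewrite /F message_tail_le0 // ?subr0 // subr_le0.
by near: s; exact: nbhs_pinfty_ge.
Unshelve. all: by end_near. Qed.

#[local] HB.instance Definition _ := isCumulative.Build R _ R F F_nd F_rc.
#[local] HB.instance Definition _ := isCumulativeBounded.Build R 0 1 F FNy Fy.

Let mF : probability (measurableTypeR R) R := lebesgue_stieltjes_measure F.

Let mF_ray s : mF `]-oo, s]%classic = (F s)%:E.
Proof. by rewrite -cdf_lebesgue_stieltjes_id. Qed.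

Context d0 (T0 : measurableType d0) (P0 : probability T0 R) (xi : {RV P0 >-> R}).
Hypothesis xiG : is_distribution_function xi G.

Let mG : probability R R := distribution P0 xi.
Let TF := measurableTypeR R.
Let P2 := ((mG \x mF)%E : probability (R * TF)%type R).
Let P' := ((mF \x P2)%E : probability (TF * (R * TF))%type R).

(** A boundary triple needs values in [[0, 1]] at every point, whereas the Stieltjes measure of [F]
    lives on the whole line. *)
Let clip01 (y : R) : R := Num.min 1 (Num.max 0 y).

Let mclip01 : measurable_fun setT (clip01 : TF -> R).
Proof. by apply: measurable_minr => //; exact: measurable_maxr. Qed.

Let clip01_itv y : 0 <= clip01 y <= 1.
Proof. by rewrite /clip01 le_min ge_min lexx ler01 le_max lexx. Qed.

Let mXL : measurable_fun setT (fun z : TF * (R * TF) => clip01 z.1).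
Proof. exact: measurableT_comp mclip01 measurable_fst. Qed.

Let mX : measurable_fun setT (fun z : TF * (R * TF) => z.2.1).
Proof. exact: measurableT_comp measurable_fst measurable_snd. Qed.

Let mXR : measurable_fun setT (fun z : TF * (R * TF) => clip01 z.2.2).
Proof.
apply: (measurableT_comp mclip01).
exact: measurableT_comp measurable_snd measurable_snd.
Qed.

Let XL : {RV P' >-> R} :=
  MeasurableFun.Pack (MeasurableFun.Class (isMeasurableFun.Build _ _ _ _ _ mXL)).
Let X : {RV P' >-> R} :=
  MeasurableFun.Pack (MeasurableFun.Class (isMeasurableFun.Build _ _ _ _ _ mX)).
Let XR : {RV P' >-> R} :=
  MeasurableFun.Pack (MeasurableFun.Class (isMeasurableFun.Build _ _ _ _ _ mXR)).

Let P'E (a : set TF) (b : set R) (c : set TF) :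
  measurable a -> measurable b -> measurable c ->
  (P' (a `*` (b `*` c)) = mF a * (mG b * mF c))%E.
Proof.
move=> ma mb mc; 
apply: (etrans (product_measure1E mF P2 ma (measurableX mb mc))).
by congr (_ * _)%E; exact: product_measure1E.
Qed.

Let mclip a : measurable a -> measurable (clip01 @^-1` a : set TF).
Proof. by move=> ma; rewrite -[_ @^-1` _]setTI; exact: mclip01. Qed.

Let preXL a : XL @^-1` a = (clip01 @^-1` a) `*` (setT `*` setT).
Proof. by apply/seteqP; split => z //= []. Qed.

Let preX b : X @^-1` b = setT `*` (b `*` setT).
Proof. by apply/seteqP; split => z //= -[_ []]. Qed.

Let preXR c : XR @^-1` c = setT `*` (setT `*` (clip01 @^-1` c)).
Proof. by apply/seteqP; split => z //= -[_ []]. Qed.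

Let P'XL a : measurable a -> P' (XL @^-1` a) = mF (clip01 @^-1` a).
Proof.
move=> ma; rewrite preXL P'E //; last exact: mclip.
by rewrite !probability_setT !mule1.
Qed.

Let P'X b : measurable b -> P' (X @^-1` b) = mG b.
Proof. by move=> mb; rewrite preX P'E // !probability_setT mule1 mul1e. Qed.

Let P'XR c : measurable c -> P' (XR @^-1` c) = mF (clip01 @^-1` c).
Proof.
move=> mc; rewrite preXR P'E //; last exact: mclip.
by rewrite !probability_setT !mul1e.
Qed.

(** For [s < 1] clipping leaves the event [y <= s] unchanged; at [s = 1] the event becomes the whole
    line, and [F 1 = 1]. *)
Let mF_clip s : 0 <= s <= 1 -> mF (clip01 @^-1` `]-oo, s]) = (cdf_F G s)%:E.
Proof.
move=> /andP[s0 s1]; rewrite cdf_F_message_tail //.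
move: s1; rewrite le_eqVlt => /predU1P[->|s1].
  rewrite (_ : _ @^-1` _ = setT); last first.
    rewrite -subTset => y _ /=; rewrite in_itv /=.
    by case/andP: (clip01_itv y).
  by rewrite probability_setT subrr message_tail_le0 // subr0.
rewrite -mF_ray; congr (mF _); apply/seteqP.
by split => y /=; rewrite !in_itv /= /clip01 ge_min leNgt s1 /= ge_max s0.
Qed.

(** The coordinates, the outer two clipped, on the product of the Stieltjes measure of [F], the law
    of [xi] and the Stieltjes measure again. *)
Lemma boundary_triple_exists : exists (d' : measure_display)
  (T' : measurableType d') (P' : probability T' R) (XL X XR : {RV P' >-> R}),
  boundary_triple G XL X XR.
Proof.
exists _, _, P', XL, X, XR; split.
- apply: mutually_independent_triple => a b c ma mb mc.
  rewrite P'XL // P'X // P'XR //; rewrite -(P'E (mclip ma) mb (mclip mc)).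
  by congr (P' _); apply/seteqP; split => z /= [] //; move=> ? [].
- by move=> s; rewrite -xiG; exact: P'X.
- by move=> z; split; exact: clip01_itv.
- by move=> s s01; rewrite -mF_clip //; split; [exact: P'XL|exact: P'XR].
Qed.

End existence.

(** * Densities, and the exponential case *)

Section density.
Context {R : realType} d0 (T0 : measurableType d0) (P0 : probability T0 R)
  (xi : {RV P0 >-> R}) (G g : R -> R).
Hypothesis xi_gt0 : forall w, 0 < xi w.
Hypothesis xi_G : is_distribution_function xi G.
Hypothesis G_g : has_bounded_continuous_density G g.
Hypothesis g_half : 0 < g 2^-1.
Local Notation mu := (@lebesgue_measure R).

Let G_nd : {homo G : x y / x <= y}.
Proof. by move=> x y xy; rewrite -lee_fin -!xi_G cdf_nondecreasing. Qed.

Let G01 x : 0 <= G x <= 1.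
Proof. by rewrite -!lee_fin -!xi_G cdf_ge0 cdf_le1. Qed.

Let G_le0 x : x <= 0 -> G x = 0.
Proof.
move=> x0; have E : xi @^-1` `]-oo, x] = set0.
  rewrite -subset0 => w /=; rewrite in_itv /= leNgt.
  by rewrite (le_lt_trans x0 (xi_gt0 w)).
by apply: EFin_inj; rewrite -xi_G -[RHS](measure0 P0) -E.
Qed.

Let mg (x y : R) : 0 <= x -> measurable_fun `]x, y] g.
Proof.
case: G_g => _ _ gc _ x0.
have mg0 : measurable_fun (`]0, +oo[%classic : set R) g.
  apply: subspace_continuous_measurable_fun => //; apply: continuous_in_subspaceT => z.
  by rewrite inE /= in_itv /= andbT; exact: gc.
apply: measurable_funS mg0 => //.
move=> z /=; rewrite !in_itv /= andbT => /andP[xz _].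
exact: le_lt_trans xz.
Qed.

Let increment (x y : R) : 0 <= x -> x <= y ->
  ((G y)%:E = (G x)%:E + \int[mu]_(t in `]x, y]) (g t)%:E)%E.
Proof.
case: (G_g) => g0 _ _ gint x0 xy.
have [y0|y0] := leP y 0.
  have y_0 : y = 0 by apply/le_anti; rewrite y0 (le_trans x0).
  have x_0 : x = 0 by apply/le_anti; rewrite x0 -y_0 xy.
  by rewrite y_0 x_0 set_itv_ge ?bnd_simp ?ltxx // integral_set0 adde0.
have gy z t : 0 <= z -> z < t -> (0 <= (g t)%:E)%E.
  by move=> z0 zt; rewrite lee_fin g0 // (le_lt_trans z0).
rewrite gint // (@itv_bndbnd_setU _ _ _ (BRight x)) ?bnd_simp //.
rewrite ge0_integral_setU //=; first last.
- apply/disj_setPS => t [/=]; rewrite !in_itv /= => /andP[_ tx] /andP[xt _].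
  by move: (lt_le_trans xt tx); rewrite ltxx.
- by move=> t [] /=; rewrite in_itv /= => /andP[xt _]; apply: gy xt.
- by rewrite -itv_bndbnd_setU ?bnd_simp //; apply/measurable_EFinP; exact: mg.
(* The density formula is available only at positive points; at [x = 0] the integral is over an
   empty interval and [G 0 = 0]. *)
congr (_ + _)%E; have [x_gt0|x_le0] := ltP 0 x; first by rewrite gint.
by rewrite set_itv_ge ?bnd_simp -?leNgt // integral_set0 G_le0.
Qed.

Let itv_length (x y : R) : x <= y -> mu `]x, y] = (y - x)%:E.
Proof.
rewrite le_eqVlt => /predU1P[->|xy]; rewrite lebesgue_measure_itv /= lte_fin.
  by rewrite ltxx subrr.
by rewrite xy -EFinB.
Qed.

(** A bound on the density is a Lipschitz constant on the nonnegative half-line; a negative left end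
    point is moved to 0, where [G] has the same value. *)
Let lipschitz : exists2 K, 0 <= K & forall x y, x <= y -> G y - G x <= K * (y - x).
Proof.
case: G_g => g0 [K gK] _ _.
have K0 : 0 <= K by rewrite (le_trans (ltW g_half)) // gK // invr_gt0.
have lip x y : 0 <= x -> x <= y -> G y - G x <= K * (y - x).
  move=> x0 xy; rewrite lerBlDl -lee_fin (increment x0 xy) EFinD leeD2l //.
  rewrite EFinM -itv_length // -integral_cst //.
  apply: ge0_le_integral => //.
  - by move=> t /=; rewrite in_itv /= => /andP[xt _]; rewrite lee_fin g0 // (le_lt_trans x0).
  - by apply/measurable_EFinP; exact: mg.
  - by move=> t /=; rewrite in_itv /= => /andP[xt _]; rewrite lee_fin gK // (le_lt_trans x0).
exists K => // x y xy; have [x0|x0] := leP 0 x; first exact: lip.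
have [y0|y0] := leP y 0; first by rewrite !G_le0 ?subrr ?mulr_ge0 ?subr_ge0 // ltW.
rewrite (G_le0 (ltW x0)) -(G_le0 (lexx 0)) (le_trans (lip 0 y _ _)) ?(ltW y0) //.
by rewrite ler_wpM2l // lerD2l lerN2 ltW.
Qed.

Let G_cont : continuous G.
Proof.
case: lipschitz => K K0 GK x.
have GKabs s t : `|G s - G t| <= K * `|s - t|.
  wlog st : s t / t <= s.
    by move=> H; have [/H//|/ltW/H] := leP t s; rewrite distrC (distrC t).
  by rewrite !ger0_norm ?subr_ge0 ?GK // G_nd.
apply/(@cvgrPdist_le _ R^o) => e e0.
have K1 : 0 < K + 1 by rewrite ltr_pwDr.
near=> y; rewrite (le_trans (GKabs _ _)) //.
rewrite (@le_trans _ _ ((K + 1) * `|x - y|)) //.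
  by rewrite ler_wpM2r // lerDl.
rewrite mulrC -ler_pdivlMr //; near: y.
by apply: cvgr_dist_le => //; rewrite divr_gt0.
Unshelve. all: by end_near. Qed.

(** By continuity [g] exceeds half of [g (1/2)] on an interval ending at 1/2, which therefore
    carries positive mass. *)
Let G_half : 0 < G 2^-1.
Proof.
case: (G_g) => g0 _ gc _; have half0 : 0 < 2^-1 :> R by rewrite invr_gt0.
have /(@cvgrPdist_lt _ R^o)/(_ (g 2^-1 / 2)) := gc _ half0.
rewrite divr_gt0 // => /(_ isT)[r /= r0 rg].
(* Both positive and within [r] of 1/2. *)
pose a := Num.max (2^-1 / 2) (2^-1 - r / 2) : R.
have a0 : 0 < a by rewrite lt_max divr_gt0.
have ah : a < 2^-1 by rewrite gt_max; apply/andP; split; lra.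
have ar : 2^-1 - r / 2 <= a by rewrite le_max lexx orbT.
have /andP[Ga _] := G01 a.
rewrite -lte_fin (increment (ltW a0) (ltW ah)).
apply: (@lt_le_trans _ _ (\int[mu]_(t in `]a, (2^-1)%R]) (g t)%:E)%E); last first.
  by rewrite leeDr // lee_fin.
apply: (@lt_le_trans _ _ (\int[mu]_(t in `]a, (2^-1)%R]) (g (2^-1) / 2)%R%:E)%E).
  rewrite integral_cst // [X in (_ * X)%E]itv_length ?ltW // -EFinM lte_fin.
  by rewrite mulr_gt0 ?divr_gt0 // subr_gt0.
apply: ge0_le_integral => //.
- by move=> t _; rewrite lee_fin divr_ge0 // ltW.
- by apply/measurable_EFinP; apply: mg; exact: ltW.
- move=> t /=; rewrite in_itv /= => /andP[at_ th]; rewrite lee_fin.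
  have : `|g 2^-1 - g t| < g 2^-1 / 2.
    by apply: rg; rewrite /= ger0_norm ?subr_ge0 //; lra.
  by move/ltr_normlW; lra.
Qed.

Lemma density_atomless_cdf : atomless_cdf G.
Proof. by split. Qed.

End density.

(** * The lower bound and the exponential value of the constant *)

Section constant.
Context {R : realType} (G : R -> R).
Hypothesis GP : atomless_cdf G.
Local Notation phi := (message_tail G).
Local Notation mu := (@lebesgue_measure R).

(** Twice the constant is the integral over [[0, 1]] of [phi s + phi (1 - s)], which is at least 1
    by the fixed-point equation and [1 - G s <= 1]. *)
Lemma potential1_ge_half : 2^-1 <= potential G 1.
Proof.
have G01 s : 0 <= G s <= 1 by case: GP.
have cphi := message_tail_continuous GP.
have cphi1 := message_tail_onem_continuous GP.
have cE : potential G 1 = \int[mu]_(s in `[0, 1]) phi (1 - s).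
  exact: potential1_onem.
suff : 1 <= potential G 1 + potential G 1 by lra.
rewrite {2}cE /potential -RintegralD //; last 2 first.
- exact: continuous_integrable_segment.
- exact: continuous_integrable_segment.
apply: (@le_trans _ _ (\int[mu]_(s in `[0%R, 1%R]) (1 : R))).
  by rewrite Rintegral_cst //= mul1r lebesgue_measure_itv /= lte_fin ltr01 /= subr0.
apply: le_Rintegral => //.
- by apply: continuous_integrable_segment => s; exact: cvg_cst.
- apply: continuous_integrable_segment => s.
  by apply: cvgD; [exact: cphi|exact: cphi1].
move=> s _; have := message_tail_fixpoint GP s.
have /andP[p0 _] := message_tail_itv GP (1 - s); have /andP[s0 s1] := G01 s.
nra.
Qed.

Lemma exponential_cdf d0 (T0 : measurableType d0) (P0 : probability T0 R)
    (xi : {RV P0 >-> R}) (lambda s : R) :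
  (forall w, 0 < xi w) -> is_distribution_function xi G ->
  exponentially_distributed xi lambda -> 0 <= s ->
  G s = 1 - expR (- lambda * s).
Proof.
move=> xi0 xiG xiexp; rewrite le_eqVlt => /predU1P[<-|s0].
  by rewrite mulr0 expR0 subrr; case: GP => _ _ + _ _; apply.
apply: EFin_inj; rewrite -xiG EFinB -exponential_prob_itv0c // -xiexp //.
congr (P0 _); apply/seteqP; split => w /=; rewrite !in_itv /= ?(ltW (xi0 w)) //.
Qed.

Lemma exponential_potential1 (lambda : R) : 0 < lambda ->
  (forall s, 0 <= s -> G s = 1 - expR (- lambda * s)) ->
  potential G 1 = (1 - expR (- lambda))^-1 - lambda^-1.
Proof.
move=> l0 GE; set q := expR (- lambda).
have q1 : q < 1 by rewrite /q -[ltRHS]expR0 ltr_expR oppr_lt0.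
have phiE s : 0 <= s <= 1 -> phi s = (1 - q)^-1 * (1 - expR (- lambda * s)).
  move=> /andP[s0 s1]; rewrite /message_tail !GE ?subr_ge0 // mulrC; congr (_^-1 * _).
  (* This factorization makes the denominator of [phi s] equal to [1 - q] for every [s] in
     [[0, 1]]. *)
  have -> : q = expR (- lambda * s) * expR (- lambda * (1 - s)).
    by rewrite /q -expRD; congr expR; ring.
  ring.
pose f s : R := (1 - q)^-1 * (1 - expR (- lambda * s)).
(* An antiderivative of [f]; [H 1 - H 0] is the claimed value. *)
pose H s : R := (1 - q)^-1 * (s + lambda^-1 * expR (- lambda * s)).
have Hf (s : R) : is_derive s 1 (H : R -> R) (f s).
  have D1 : is_derive s 1 (fun t : R => - lambda * t) (- lambda).
    have := is_deriveZ (- lambda) (is_derive_id s (1 : R)).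
    by rewrite /GRing.scale /= mulr1.
  have D2 := is_derive1_comp (is_derive_expR (- lambda * s)) D1.
  have D3 := is_deriveZ (1 - q)^-1
    (is_deriveD (is_derive_id s (1 : R)) (is_deriveZ lambda^-1 D2)).
  apply: (is_derive_eq D3); rewrite /f /GRing.scale /=; congr (_ * _).
  by rewrite mulrCA mulrN mulVf ?lt0r_neq0 // mulrN1.
have Hc : continuous H.
  by move=> s; apply/differentiable_continuous/derivable1_diffP; exact: ex_derive.
rewrite /potential.
have -> : \int[mu]_(s in `[0, 1]) phi s = \int[mu]_(s in `[0, 1]) f s.
  by apply: eq_Rintegral => s; rewrite inE /= in_itv /= => s01; exact: phiE.
rewrite /Rintegral (@continuous_FTC2 _ f H 0 1) //.
- rewrite -EFinB /= /H !mulr0 expR0 mulr1 add0r -/q; field.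
  by rewrite !lt0r_neq0 // subr_gt0.
- apply: continuous_subspaceT => s; apply: cvgM; first exact: cvg_cst.
  apply: cvgB; first exact: cvg_cst.
  apply: (@continuous_comp _ _ _ (fun t : R => - lambda * t) (@expR R)).
    by apply: cvgM; [exact: cvg_cst|exact: cvg_id].
  exact: continuous_expR.
- split.
  + by move=> s _; exact: ex_derive.
  + by apply: cvg_at_right_filter; exact: Hc.
  + by apply: cvg_at_left_filter; exact: Hc.
- by move=> s _; rewrite derive1E; exact: derive_val.
Qed.

End constant.

Theorem theorem1 (R : realType)
    (d0 : measure_display) (T0 : measurableType d0) (P0 : probability T0 R)
    (xi : {RV P0 >-> R}) (G g : R -> R)
    (d : measure_display) (T : measurableType d) (P : probability T R)
    (xis : nat -> {RV P >-> R})
    (xi_gt0 : forall w, 0 < xi w)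
    (xi_G : is_distribution_function xi G)
    (G_g : has_bounded_continuous_density G g)
    (g_half : 0 < g (2^-1))
    (xis_iid : iid_copies xi xis) :
  let M := fun (n : nat) (w : T) => max_penalized_card (fun i => xis i w) n in
  exists c : R,
    [/\ 2^-1 <= c <= 1,
        {ae P, forall w, n%:R^-1 * M n w @[n --> \oo] --> c},
        cvg_L1 P (fun n w => n%:R^-1 * M n w) c,
        (exists (d' : measure_display) (T' : measurableType d')
           (P' : probability T' R) (XL X XR : {RV P' >-> R}),
           boundary_triple G XL X XR) /\
        (forall (d' : measure_display) (T' : measurableType d')
           (P' : probability T' R) (XL X XR : {RV P' >-> R}),
           boundary_triple G XL X XR -> constant_formula c XL X XR) &
        forall lambda : R, 0 < lambda ->
          exponentially_distributed xi lambda ->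
          c = (1 - expR (- lambda))^-1 - lambda^-1].
Proof.
have GP : atomless_cdf G by exact: density_atomless_cdf xi_gt0 xi_G G_g g_half.
have [xis_indep xis_law] := xis_iid.
have xis_G n : is_distribution_function (xis n) G.
  by move=> s; rewrite -xi_G; exact: xis_law.
move=> M; exists (potential G 1); split.
- rewrite (potential1_ge_half GP) /=; exact: potential_le1.
- exact: ae_cvg_max_penalized_card.
- exact: cvg_L1_max_penalized_card.
- split; first exact: (boundary_triple_exists GP xi_G).
  by move=> d' T' P' XL X XR; exact: boundary_triple_constant.
- move=> lambda l0 xi_exp; apply: (exponential_potential1 l0) => s.
  exact: (exponential_cdf GP xi_gt0 xi_G xi_exp).
Qed.
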